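(* Let $\Gamma$ be a discrete, finitely generated group with polynomial growth and homogeneous dimension $d_h$. Let $\lambda(\Gamma)''$ be the von Neumann algebra generated by the left regular representation $\lambda$ of $\Gamma$ on $\ell^2(\Gamma)$, and let $\tau$ be its trace. Then there exists on $L^2(\lambda(\Gamma)'',\tau)$ a noncommutative Dirichlet form $(\mathcal{E},\mathcal{F})$ with discrete spectrum and upper spectral dimension $d_S\le d_h$.
   Context: Growth: let $K\subset\Gamma$ be a finite symmetric generating set containing the identity $e$, and $K^n=\{s_1\cdots s_n:s_i\in K\}$. The group $\Gamma$ has polynomial growth if there exist $c,d>0$ with $\sharp K^n\le c(n+1)^d$ for all $n\ge1$. In that case its homogeneous dimension is $d_h=\limsup_{n\to\infty}\frac{\log \sharp K^n}{\log n}$ (independent of $K$). Trace: $\tau(x)=\langle \delta_e,x\delta_e\rangle$ is the canonical faithful normal tracial state on $\lambda(\Gamma)''$, and $L^2(\lambda(\Gamma)'',\tau)$ is its GNS Hilbert space. Dirichlet form: let $(M,\tau)$ be a von Neumann algebra with a faithful normal tracial state, and let $J$ be the antiunitary extension of $a\mapsto a^*$ to $L^2(M,\tau)$. For $a=Ja$ let $a\wedge 1$ denote the Hilbert-space projection of $a$ onto the closed convex set $\{b=Jb\in L^2(M,\tau): b\le 1\}$ (order induced by the closure of the cone $M_+$). A noncommutative Dirichlet form is a densely defined, closed (lower semicontinuous), nonnegative quadratic form $\mathcal{E}:\mathcal{F}\to[0,+\infty)$ on $L^2(M,\tau)$ which is real ($J\mathcal{F}\subset\mathcal{F}$ and $\mathcal{E}[Ja]=\mathcal{E}[a]$)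 and Markovian ($a\wedge1\in\mathcal{F}$ and $\mathcal{E}[a\wedge 1]\le\mathcal{E}[a]$ for all $a=Ja\in\mathcal{F}$). Spectrum: let $(L,\mathrm{dom}(L))$ be the nonnegative self-adjoint operator associated to $(\mathcal{E},\mathcal{F})$, i.e. $\mathcal{F}=\mathrm{dom}(\sqrt L)$ and $\mathcal{E}[a]=\|\sqrt{L}a\|_2^2$ for $a\in\mathcal{F}$. The form has discrete spectrum if the spectrum $\mathrm{sp}(L)$ of $L$ consists of isolated eigenvalues of finite multiplicity. The upper spectral dimension is $$d_S:=\inf\Big\{d>0:\ \limsup_{x\to+\infty}\frac{\sharp\{\lambda\in\mathrm{sp}(L):\lambda\le x\}}{x^d}<+\infty\Big\},$$ where eigenvalues are counted with multiplicity. *)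

(* Defs.v *)
From HB Require Import structures.
From mathcomp Require Import all_boot all_order all_algebra finmap.
From mathcomp Require Import complex ring lra.
From mathcomp Require Import mathcomp_extra boolp classical_sets functions.
From mathcomp Require Import cardinality fsbigop reals ereal interval_inference.
From mathcomp Require Import topology normedtype sequences esum exp.

Set Implicit Arguments.
Unset Strict Implicit.
Unset Printing Implicit Defensive.

Import Order.TTheory GRing.Theory Num.Theory.
Import numFieldNormedType.Exports.

Local Open Scope classical_set_scope.
Local Open Scope ring_scope.
Local Open Scope complex_scope.

Local Notation Re := complex.Re.
Local Notation Im := complex.Im.

(* The inner product is linear in its second argument. *)
HB.mixin Record CompleteNormedModule_isHilbert (R : realType) V
    & CompleteNormedModule R[i] V := {
  hdot : V -> V -> R[i] ;
  hdotPr : forall (x : V) (z : R[i]) (u v : V),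
    hdot x (z *: u + v) = z * hdot x u + hdot x v ;
  hdotC : forall x y : V, hdot x y = (hdot y x)^* ;
  hdotxx : forall x : V, hdot x x = `|x| ^+ 2
}.

#[short(type="hilbertType")]
HB.structure Definition Hilbert (R : realType) :=
  { V of CompleteNormedModule_isHilbert R V & CompleteNormedModule R[i] V }.

Section sums.
Context {R : realType} {T : choiceType}.
Implicit Types (f g h : T -> R) (F G : T -> R[i]).

(* Unordered sums over T: [rsum] and [csum] are meant for absolutely summable
   families and take a junk value elsewhere. *)
Definition rsummable f : Prop :=
  (\esum_(i in [set: T]) `|f i|%:E < +oo)%E.

Definition rsum f : R :=
  fine (\esum_(i in [set: T]) (Num.max (f i) 0)%:E) -
  fine (\esum_(i in [set: T]) (Num.max (- f i) 0)%:E).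

Definition csummable F : Prop :=
  rsummable (fun i => Re (F i)) /\ rsummable (fun i => Im (F i)).

Definition csum F : R[i] :=
  rsum (fun i => Re (F i)) +i* rsum (fun i => Im (F i)).

Lemma le_rsummable f g : (forall i, `|f i| <= `|g i|) ->
  rsummable g -> rsummable f.
Proof.
by move=> fg; apply: le_lt_trans; apply: le_esum => i _; rewrite lee_fin.
Qed.

Lemma rsummableD f g : rsummable f -> rsummable g ->
  rsummable (fun i => f i + g i).
Proof.
move=> sf sg; apply: (@le_lt_trans _ _
  (\esum_(i in [set: T]) (`|f i|%:E + `|g i|%:E))).
  by apply: le_esum => i _; rewrite -EFinD lee_fin ler_normD.
by rewrite esumD ?lte_add_pinfty// => i _; rewrite lee_fin.
Qed.

Lemma rsummableN f : rsummable f -> rsummable (fun i => - f i).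
Proof. by apply: le_rsummable => i; rewrite normrN. Qed.

Lemma rsum_pos f : (forall i, 0 <= f i) ->
  rsum f = fine (\esum_(i in [set: T]) (f i)%:E).
Proof.
move=> f0; rewrite /rsum.
rewrite [X in _ - fine X]esum1 ?subr0; last first.
  by move=> i _; rewrite max_r// oppr_le0.
by congr fine; apply: eq_esum => i _; rewrite max_l.
Qed.

Lemma rsummable_fin f : (forall i, 0 <= f i) -> rsummable f ->
  (\esum_(i in [set: T]) (f i)%:E)%E \is a fin_num.
Proof.
move=> f0 sf; rewrite ge0_fin_numE; last by apply: esum_ge0 => i _; rewrite lee_fin.
apply: le_lt_trans sf; apply: le_esum => i _; rewrite lee_fin ger0_norm//.
Qed.

Lemma rsum_posD f g : (forall i, 0 <= f i) -> (forall i, 0 <= g i) ->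
  rsummable f -> rsummable g -> rsum (fun i => f i + g i) = rsum f + rsum g.
Proof.
move=> f0 g0 sf sg; rewrite !rsum_pos//; last by move=> i; rewrite addr_ge0.
under eq_esum do rewrite EFinD.
rewrite esumD; try by move=> i _; rewrite lee_fin.
by rewrite fineD ?rsummable_fin.
Qed.

Lemma rsumE f : rsum f =
  rsum (fun i => Num.max (f i) 0) - rsum (fun i => Num.max (- f i) 0).
Proof. by rewrite {1}/rsum !rsum_pos// => i; rewrite le_max lexx orbT. Qed.

Lemma rsummable_max f : rsummable f -> rsummable (fun i => Num.max (f i) 0).
Proof.
apply: le_rsummable => i; rewrite ger0_norm ?le_max ?lexx ?orbT//.
by rewrite ge_max normr_ge0 ler_norm.
Qed.

Lemma rsum_diff g h : (forall i, 0 <= g i) -> (forall i, 0 <= h i) ->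
  rsummable g -> rsummable h ->
  rsum (fun i => g i - h i) = rsum g - rsum h.
Proof.
move=> g0 h0 sg sh; rewrite rsumE.
have sgh : rsummable (fun i => g i - h i).
  by apply: rsummableD => //; exact: rsummableN.
have m0 (x : R) : 0 <= Num.max x 0 by rewrite le_max lexx orbT.
suff : rsum (fun i => Num.max (g i - h i) 0) + rsum h =
       rsum (fun i => Num.max (- (g i - h i)) 0) + rsum g by lra.
have s1 := rsummable_max sgh.
have s2 := rsummable_max (rsummableN sgh).
rewrite -!rsum_posD//; try by move=> i; exact: m0.
by congr rsum; apply/funext => i; case: (leP (g i - h i)); case: (leP (-(g i - h i))); lra.
Qed.

Lemma rsumN f : rsum (fun i => - f i) = - rsum f.
Proof.
by rewrite /rsum opprB; congr (_ - fine _); apply: eq_esum => i _; rewrite opprK.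
Qed.

Lemma rsumD f g : rsummable f -> rsummable g ->
  rsum (fun i => f i + g i) = rsum f + rsum g.
Proof.
move=> sf sg; rewrite (rsumE f) (rsumE g).
have m0 (x : R) : 0 <= Num.max x 0 by rewrite le_max lexx orbT.
have [sfp sgp] := (rsummable_max sf, rsummable_max sg).
have [sfn sgn] := (rsummable_max (rsummableN sf), rsummable_max (rsummableN sg)).
rewrite addrACA -opprD -!rsum_posD//; try by move=> i; exact: m0.
rewrite -rsum_diff; try (by move=> i; rewrite addr_ge0);
  try exact: rsummableD.
congr rsum; apply/funext => i.
by case: (leP (f i)); case: (leP (g i)); case: (leP (- f i)); case: (leP (- g i)); lra.
Qed.

Lemma rsum_ge0 f : (forall i, 0 <= f i) -> 0 <= rsum f.
Proof.
by move=> f0; rewrite rsum_pos// fine_ge0// esum_ge0// => i _; rewrite lee_fin.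
Qed.

Lemma le_rsum f g : rsummable f -> rsummable g -> (forall i, f i <= g i) ->
  rsum f <= rsum g.
Proof.
move=> sf sg fg; rewrite -subr_ge0 -rsumN -rsumD//; last exact: rsummableN.
by apply: rsum_ge0 => i; rewrite subr_ge0.
Qed.

Lemma esum_pZl (k : R) f : 0 < k ->
  (\esum_(i in [set: T]) (k * f i)%:E = k%:E * \esum_(i in [set: T]) (f i)%:E)%E.
Proof.
move=> k0; rewrite /esum -ereal_sup_pZl//; congr ereal_sup.
rewrite image_comp; apply/eq_imagel => A -[finA _] /=.
by rewrite !fsumEFin// -EFinM -mulr_fsumr.
Qed.

Lemma rsummableZ k f : rsummable f -> rsummable (fun i => k * f i).
Proof.
move=> sf; have [->|k0] := eqVneq k 0.
  by rewrite /rsummable esum1// => i _; rewrite mul0r normr0.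
rewrite /rsummable; under eq_esum do rewrite normrM.
by rewrite esum_pZl ?normr_gt0// lte_mul_pinfty ?lee_fin.
Qed.

Lemma rsumZ k f : rsum (fun i => k * f i) = k * rsum f.
Proof.
wlog k0 : k / 0 < k => [hw|].
  have [/hw//|k0|<-] := ltgtP 0 k.
    have := hw (- k); rewrite oppr_gt0 => /(_ k0).
    rewrite mulNr => hk; apply: oppr_inj; rewrite -hk -rsumN.
    by congr rsum; apply/funext => i; rewrite mulNr.
  by rewrite mul0r rsum_pos ?esum1//= => i; rewrite mul0r.
have kfine (x : \bar R) : fine (k%:E * x)%E = k * fine x.
  by case: x => [r| |]//=; rewrite ?gt0_muley ?gt0_muleNy ?lte_fin//= mulr0.
rewrite /rsum mulrBr -!kfine -!esum_pZl//.
by congr (fine _ - fine _); apply: eq_esum => i _;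
  rewrite ?maxr_pMr ?mulr0 ?mulrN// ltW.
Qed.

End sums.

Section l2_space.
Context {R : realType} {T : choiceType}.

Definition sqmod (z : R[i]) : R := Re z ^+ 2 + Im z ^+ 2.

Lemma sqmod_ge0 z : 0 <= sqmod z.
Proof. by rewrite addr_ge0 ?sqr_ge0. Qed.

Lemma sqmodM z w : sqmod (z * w) = sqmod z * sqmod w.
Proof. by case: z w => [a b] [c d]; rewrite /sqmod /=; ring. Qed.

Lemma norm_sqmod z : `|z| = (Num.sqrt (sqmod z))%:C.
Proof. exact: normc_def. Qed.

Definition l2_pred : {pred T -> R[i]} :=
  fun f => `[< rsummable (fun i => sqmod (f i)) >].

Lemma l2_submod_closed : submod_closed l2_pred.
Proof.
split=> [|z f g /asboolP sf /asboolP sg]; apply/asboolP.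
  rewrite /rsummable esum1// => i _.
  have -> : (0 : T -> R[i]) i = 0 by [].
  by rewrite /sqmod /= expr0n/= addr0 normr0.
have := rsummableZ 2 (rsummableD (rsummableZ (sqmod z) sf) sg).
apply: le_rsummable => i; rewrite !ger0_norm ?sqmod_ge0//; last first.
  by apply: mulr_ge0 => //; rewrite addr_ge0 ?mulr_ge0 ?sqmod_ge0.
have -> : (z *: f + g) i = z * f i + g i by [].
rewrite -sqmodM; move: (z * f i) (g i) => [a b] [c d].
rewrite /sqmod /=.
have : 0 <= (a - c) ^+ 2 + (b - d) ^+ 2 by rewrite addr_ge0 ?sqr_ge0.
nra.
Qed.

HB.instance Definition _ :=
  GRing.isSubmodClosed.Build R[i] (T -> R[i]) l2_pred
    (GRing.submod_closed_semi l2_submod_closed).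

Record l2 := L2 { l2_fun :> T -> R[i] ; l2P : l2_fun \in l2_pred }.

HB.instance Definition _ := [isSub for l2_fun].
HB.instance Definition _ := [Choice of l2 by <:].
HB.instance Definition _ := [SubChoice_isSubLmodule of l2 by <:].

Implicit Types x y : l2.

Definition l2_dot x y : R[i] := csum (fun i => (x i)^* * y i).

Lemma l2_sq x : rsummable (fun i => sqmod (x i)).
Proof. exact/asboolP/l2P. Qed.

Lemma l2_scaleE (z : R[i]) x i : (z *: x) i = z * x i. Proof. by []. Qed.
Lemma l2_addE x y i : (x + y) i = x i + y i. Proof. by []. Qed.

Lemma csummable_dot x y : csummable (fun i => (x i)^* * y i).
Proof.
have sxy := rsummableD (l2_sq x) (l2_sq y).
have s0 i : 0 <= sqmod (x i) + sqmod (y i).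
  by apply: addr_ge0; exact: sqmod_ge0.
split; apply: le_rsummable sxy => i; rewrite (ger0_norm (s0 i)) {s0};
  case: (x i) (y i) => [a b] [c d]; rewrite /sqmod /= ler_norml;
  apply/andP; split; have := sqr_ge0 (a + c); have := sqr_ge0 (a - c);
  have := sqr_ge0 (b + d); have := sqr_ge0 (b - d);
  have := sqr_ge0 (a + d); have := sqr_ge0 (a - d);
  have := sqr_ge0 (b + c); have := sqr_ge0 (b - c); nra.
Qed.

Lemma csumD (F G : T -> R[i]) : csummable F -> csummable G ->
  csum (fun i => F i + G i) = csum F + csum G.
Proof.
move=> [sF1 sF2] [sG1 sG2]; apply/eqP; rewrite eq_complex /=.
rewrite -!rsumD//; apply/andP; split; apply/eqP; congr rsum;
  by apply/funext => i; case: (F i) (G i) => [a b] [c d].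
Qed.

Lemma csumZ (z : R[i]) (F : T -> R[i]) : csummable F ->
  csum (fun i => z * F i) = z * csum F.
Proof.
case: z => a b [sF1 sF2]; apply/eqP; rewrite eq_complex /=.
rewrite -!rsumZ -rsumN -!rsumD//; try by [exact: rsummableZ
  | exact/rsummableN/rsummableZ].
by apply/andP; split; apply/eqP; congr rsum; apply/funext => i; case: (F i).
Qed.

Lemma csummableZ (z : R[i]) (F : T -> R[i]) : csummable F ->
  csummable (fun i => z * F i).
Proof.
case: z => a b [sF1 sF2]; split.
  have := rsummableD (rsummableZ a sF1) (rsummableN (rsummableZ b sF2)).
  by apply: le_rsummable => i; case: (F i).
have := rsummableD (rsummableZ a sF2) (rsummableZ b sF1).
by apply: le_rsummable => i; case: (F i).
Qed.

Lemma l2_dotPr x (z : R[i]) u v :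
  l2_dot x (z *: u + v) = z * l2_dot x u + l2_dot x v.
Proof.
have su := csummable_dot x u; have sv := csummable_dot x v.
rewrite /l2_dot -csumZ// -(csumD (csummableZ z su) sv).
by congr csum; apply/funext => i; rewrite l2_addE l2_scaleE; ring.
Qed.

Lemma l2_dotC x y : l2_dot x y = (l2_dot y x)^*.
Proof.
rewrite /l2_dot /csum /= -rsumN; congr (_ +i* _); congr rsum;
  by apply/funext => i; case: (x i) (y i) => [a b] [c d] /=; ring.
Qed.

Definition l2_sqnorm x : R := rsum (fun i => sqmod (x i)).

Lemma l2_dotxx x : l2_dot x x = (l2_sqnorm x)%:C.
Proof.
apply/eqP; rewrite eq_complex /=; apply/andP; split; apply/eqP.
  by congr rsum; apply/funext => i; case: (x i) => a b; rewrite /sqmod /=; ring.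
rewrite rsum_pos => [|i]; last by case: (x i) => a b /=; lra.
by rewrite esum1// => i _; case: (x i) => a b /=; congr EFin; ring.
Qed.

Lemma l2_sqnorm_ge0 x : 0 <= l2_sqnorm x.
Proof. by apply: rsum_ge0 => i; exact: sqmod_ge0. Qed.

Lemma l2_sqnormZ (z : R[i]) x : l2_sqnorm (z *: x) = sqmod z * l2_sqnorm x.
Proof.
rewrite /l2_sqnorm -rsumZ; congr rsum; apply/funext => i.
by rewrite l2_scaleE sqmodM.
Qed.

Lemma l2_sqnormD x y :
  l2_sqnorm (x + y) = l2_sqnorm x + 2 * Re (l2_dot x y) + l2_sqnorm y.
Proof.
have [sxy _] := csummable_dot x y.
have sxy2 := rsummableZ 2 sxy.
have -> : Re (l2_dot x y) = rsum (fun i => Re ((x i)^* * y i)) by [].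
rewrite -rsumZ /l2_sqnorm -(rsumD (l2_sq x) sxy2).
rewrite -(rsumD (rsummableD (l2_sq x) sxy2) (l2_sq y)).
congr rsum; apply/funext => i; rewrite l2_addE.
by case: (x i) (y i) => [a b] [c d]; rewrite /sqmod /=; ring.
Qed.

Lemma l2_CauchySchwarz x y :
  Re (l2_dot x y) <= Num.sqrt (l2_sqnorm x) * Num.sqrt (l2_sqnorm y).
Proof.
set B := Re _; have A0 := l2_sqnorm_ge0 x; have C0 := l2_sqnorm_ge0 y.
rewrite -sqrtrM//; have [B0|B0] := leP B 0.
  by rewrite (le_trans B0)// sqrtr_ge0.
apply: (le_trans (ler_norm B)); rewrite -sqrtr_sqr ler_wsqrtr//.
have q (t : R) : 0 <= l2_sqnorm x + 2 * (t * B) + t ^+ 2 * l2_sqnorm y.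
  have := l2_sqnorm_ge0 (x + t%:C *: y); rewrite l2_sqnormD l2_sqnormZ.
  have -> : Re (l2_dot x (t%:C *: y)) = t * B.
    have := l2_dotPr x t%:C y 0; rewrite addr0 => ->.
    have -> : l2_dot x 0 = 0.
      by have := l2_dotPr x (-1) 0 0; rewrite scaler0 addr0 mulN1r addrC subrr.
    rewrite addr0 /B; case: (l2_dot x y) => a b /=; ring.
  by rewrite /sqmod /= expr0n/= addr0.
have [C00|Cpos] := eqVneq (l2_sqnorm y) 0.
  have := q (- (l2_sqnorm x + 1) / (2 * B)).
  rewrite C00 mulr0 addr0.
  have -> : 2 * (- (l2_sqnorm x + 1) / (2 * B) * B) = - (l2_sqnorm x + 1).
    by field; rewrite gt_eqF.
  lra.
have Cp : 0 < l2_sqnorm y by rewrite lt_def Cpos.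
have := q (- B / l2_sqnorm y).
have -> : l2_sqnorm x + 2 * (- B / l2_sqnorm y * B) +
  (- B / l2_sqnorm y) ^+ 2 * l2_sqnorm y =
  (l2_sqnorm x * l2_sqnorm y - B ^+ 2) / l2_sqnorm y by field.
by rewrite pmulr_lge0 ?invr_gt0// subr_ge0.
Qed.

Definition l2_norm x : R[i] := (Num.sqrt (l2_sqnorm x))%:C.

Lemma ler_l2_normD x y : l2_norm (x + y) <= l2_norm x + l2_norm y.
Proof.
rewrite /l2_norm -raddfD/= lecR -(ler_pXn2r (ltn0Sn 1)) ?nnegrE ?addr_ge0 ?sqrtr_ge0//.
rewrite sqrrD !sqr_sqrtr ?l2_sqnorm_ge0// l2_sqnormD lerD2r lerD2l.
have := l2_CauchySchwarz x y; lra.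
Qed.

Lemma l2_normrZ (z : R[i]) x : l2_norm (z *: x) = `|z| * l2_norm x.
Proof.
by rewrite /l2_norm l2_sqnormZ sqrtrM ?sqmod_ge0// norm_sqmod -rmorphM.
Qed.

Lemma sqmod_le_sqnorm x i : sqmod (x i) <= l2_sqnorm x.
Proof.
have x0 j : 0 <= sqmod (x j) by exact: sqmod_ge0.
rewrite /l2_sqnorm rsum_pos// -lee_fin fineK; last first.
  by apply: rsummable_fin => //; exact: l2_sq.
by apply: esum_ge; exists [set i] => //; rewrite fsbig_set1.
Qed.

Lemma sqmod_eq0 (z : R[i]) : sqmod z = 0 -> z = 0.
Proof.
case: z => a b /eqP; rewrite /sqmod /= paddr_eq0 ?sqr_ge0// !sqrf_eq0.
by move=> /andP[/eqP -> /eqP ->].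
Qed.

Lemma l2_normr0_eq0 x : l2_norm x = 0 -> x = 0.
Proof.
move=> [] /eqP; rewrite sqrtr_eq0 => x0; apply/val_inj/funext => i /=.
apply/sqmod_eq0/le_anti; rewrite sqmod_ge0 andbT.
exact: le_trans (sqmod_le_sqnorm x i) x0.
Qed.

HB.instance Definition _ := Lmodule_isNormed.Build R[i] (l2)
  ler_l2_normD l2_normrZ l2_normr0_eq0.

Lemma l2_normE x : `|x| = (Num.sqrt (l2_sqnorm x))%:C. Proof. by []. Qed.

Lemma pos_complexP (e : R[i]) : 0 < e -> exists2 r : R, 0 < r & e = r%:C.
Proof.
case: e => a b; rewrite ltcE /= => /andP[/eqP -> a0].
by exists a.
Qed.

Lemma l2_ball x y (r : R) : 0 < r ->
  ball x r%:C y -> l2_sqnorm (x - y) <= r ^+ 2.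
Proof.
move=> r0; rewrite -ball_normE /ball_ /= l2_normE ltcR => h.
rewrite -[leLHS]sqr_sqrtr ?l2_sqnorm_ge0// ler_pXn2r ?nnegrE ?sqrtr_ge0//.
  exact: ltW.
exact: ltW.
Qed.

Lemma l2_subE x y i : (x - y) i = x i - y i. Proof. by []. Qed.

Lemma cvg_seq_sum (F : set_system l2) (FF : ProperFilter F)
    (g : T -> l2 -> R) (l : T -> R) (s : seq T) :
  (forall i, g i @ F --> l i) ->
  (fun y => \sum_(i <- s) g i y) @ F --> \sum_(i <- s) l i.
Proof.
move=> gl; elim: s => [|i s IH].
  rewrite big_nil (_ : (fun _ => _) = cst 0); first exact: cvg_cst.
  by apply/funext => y; rewrite big_nil.
rewrite big_cons (_ : (fun _ => _) = g i \+ (fun y => \sum_(i <- s) g i y)).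
  exact: cvgD.
by apply/funext => y; rewrite big_cons.
Qed.

Lemma rsum_le_fset (f : T -> R) (M : R) : (forall i, 0 <= f i) ->
  (forall s : seq T, uniq s -> \sum_(i <- s) f i <= M) ->
  rsummable f /\ rsum f <= M.
Proof.
move=> f0 fM.
have fle : (\esum_(i in [set: T]) (f i)%:E <= M%:E)%E.
  apply: ge_ereal_sup => _ [X [finX _] <-].
  by rewrite fsbig_finite//= sumEFin lee_fin fM.
have sf : rsummable f.
  rewrite /rsummable; under eq_esum do rewrite ger0_norm//.
  by rewrite (le_lt_trans fle) ?ltry.
by split=> //; rewrite rsum_pos// -lee_fin fineK// rsummable_fin.
Qed.

Lemma rsum_ge_seq (f : T -> R) (s : seq T) : (forall i, 0 <= f i) ->
  rsummable f -> uniq s -> \sum_(i <- s) f i <= rsum f.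
Proof.
move=> f0 sf us; rewrite rsum_pos// -lee_fin fineK ?rsummable_fin//.
apply: esum_ge; exists [set` s] => //.
by rewrite -fsbig_seq// sumEFin.
Qed.

Lemma l2_complete (F : set_system l2) : ProperFilter F -> cauchy F -> cvg F.
Proof.
move=> FF /cauchyP Fc.
have Fr (r : R) : 0 < r -> exists x, F (ball x r%:C).
  by move=> r0; apply: Fc; rewrite ltcR.
have pw (p : R[i] -> R) : (forall z w, p (z - w) = p z - p w) ->
    (forall z, p z ^+ 2 <= sqmod z) -> forall i, cvg ((fun y : l2 => p (y i)) @ F).
  move=> pB psq i; apply: cauchy_cvg; apply: cauchy_exP => r r0.
  have [x Fx] := Fr _ r0; exists (p (x i)).
  suff : F [set y : l2 | ball (p (x i)) r (p (y i))] by [].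
  apply: filterS Fx => y; rewrite -!ball_normE /ball_ /= l2_normE ltcR.
  apply: le_lt_trans; rewrite -pB -sqrtr_sqr ler_wsqrtr//.
  exact: le_trans (psq _) (sqmod_le_sqnorm (x - y) i).
have cRe := pw (@complex.Re R) (fun z w => raddfB _ z w).
have cIm := pw (@complex.Im R) (fun z w => raddfB _ z w).
have {pw}cRe i : cvg ((fun y : l2 => Re (y i)) @ F).
  by apply: cRe => z; rewrite lerDl sqr_ge0.
have {}cIm i : cvg ((fun y : l2 => Im (y i)) @ F).
  by apply: cIm => z; rewrite lerDr sqr_ge0.
pose a i : R[i] :=
  lim ((fun y : l2 => Re (y i)) @ F) +i* lim ((fun y : l2 => Im (y i)) @ F).
have bnd (r : R) x (s : seq T) : 0 < r -> F (ball x r%:C) -> uniq s ->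
    \sum_(i <- s) sqmod (x i - a i) <= r ^+ 2.
  move=> r0 Fx us.
  have cs : (fun y : l2 => \sum_(i <- s) sqmod (x i - y i)) @ F -->
      \sum_(i <- s) sqmod (x i - a i).
    apply: cvg_seq_sum => i; rewrite /sqmod.
    have -> : (fun y : l2 => Re (x i - y i) ^+ 2 + Im (x i - y i) ^+ 2) =
      (fun y : l2 => (Re (x i) - Re (y i)) * (Re (x i) - Re (y i)) +
         (Im (x i) - Im (y i)) * (Im (x i) - Im (y i))).
      by apply/funext => y; rewrite !raddfB/= !expr2.
    rewrite !raddfB !expr2 /a /=.
    by apply: cvgD; apply: cvgM; apply: cvgB; try exact: cvg_cst;
      [exact: cRe|exact: cRe|exact: cIm|exact: cIm].
  apply: (cvgr_to_le cs); apply: filterS Fx => y /(l2_ball r0).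
  apply: le_trans; apply: (@rsum_ge_seq (fun i => sqmod ((x - y) i))) => // [i|].
    exact: sqmod_ge0.
  exact: l2_sq.
have [x0 Fx0] := Fr 1 ltr01.
have sxa r x : 0 < r -> F (ball x r%:C) ->
    rsummable (fun i => sqmod (x i - a i)) /\
    rsum (fun i => sqmod (x i - a i)) <= r ^+ 2.
  move=> r0 Fx; apply: rsum_le_fset => [i|s us]; first exact: sqmod_ge0.
  exact: bnd.
have d0P : (fun i => x0 i - a i) \in l2_pred.
  by apply/asboolP; have [] := sxa 1 x0 ltr01 Fx0.
pose al : l2 := x0 - L2 d0P.
have alE i : al i = a i.
  by rewrite l2_subE /= opprB addrC subrK.
apply/cvg_ex; exists al; apply/cvg_ballP => e /pos_complexP[r r0 ->].
have r20 : 0 < r / 4 by rewrite divr_gt0// ltr0n.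
have [x Fx] := Fr _ r20.
apply: filterS (Fx) => y; rewrite -ball_normE /ball_ /= => xy.
have xa : `|al - x| <= (r / 4)%:C.
  rewrite distrC l2_normE lecR.
  have -> : r / 4 = Num.sqrt ((r / 4) ^+ 2) by rewrite sqrtr_sqr gtr0_norm.
  rewrite ler_wsqrtr//.
  have [_] := sxa _ _ r20 Fx; apply: le_trans.
  rewrite /l2_sqnorm le_eqVlt; apply/orP; left; apply/eqP; congr rsum.
  by apply/funext => i; rewrite l2_subE alE.
have -> : al - y = (al - x) + (x - y) by rewrite addrA subrK.
apply: le_lt_trans (ler_normD _ _) _.
apply: le_lt_trans (lerD xa (ltW xy)) _.
by rewrite -raddfD/= ltcR; lra.
Qed.

HB.instance Definition _ := Uniform_isComplete.Build l2 l2_complete.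

Lemma l2_dot_norm x : l2_dot x x = `|x| ^+ 2.
Proof.
by rewrite l2_dotxx l2_normE -rmorphXn/= sqr_sqrtr ?l2_sqnorm_ge0.
Qed.

HB.instance Definition _ := CompleteNormedModule_isHilbert.Build R l2
  l2_dotPr l2_dotC l2_dot_norm.

End l2_space.
Arguments l2 R T : clear implicits.

Section operator_algebras.
Context {R : realType} {H : hilbertType R}.
Implicit Types (x y : H -> H) (S M : set (H -> H)).

Definition bounded_op : set (H -> H) := [set x | linear x /\ continuous x].

Definition commutant S : set (H -> H) :=
  [set x | bounded_op x /\ forall y, S y -> x \o y = y \o x].

Definition adjoint_op x y : Prop := forall u v : H, hdot (x u) v = hdot u (y v).

Definition positive_op x : Prop := forall u : H, 0 <= hdot u (x u).

End operator_algebras.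

Section group_von_Neumann_algebra.
Context {R : realType} {G : groupType}.

Lemma left_regular_subproof (g : G) (x : l2 R G) :
  (fun h => x (g^-1 * h)%g) \in l2_pred.
Proof.
apply/asboolP; have := l2_sq x; rewrite /rsummable.
rewrite (reindex_esum [set: G] [set: G] (fun h => (g^-1 * h)%g))//.
split=> // [h k _ _|h _] /=; first exact: mulgI.
by exists (g * h)%g => //=; rewrite mulKg.
Qed.

Definition left_regular (g : G) (x : l2 R G) : l2 R G :=
  L2 (left_regular_subproof g x).

Lemma delta_subproof (g : G) :
  (fun h => (h == g)%:R : R[i]) \in l2_pred.
Proof.
apply/asboolP; rewrite /rsummable.
rewrite (esumID [set g])// setI1 mem_set// esum_set1 ?lee_fin//.
rewrite esum1 ?adde0 ?ltry// => h [_ /= /eqP/negbTE ->].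
by rewrite /sqmod /= expr0n/= addr0 normr0.
Qed.

Definition delta (g : G) : l2 R G := L2 (delta_subproof g).

(* The set of operators lambda(G) is closed under adjoints and contains the
   identity, so its bicommutant is the von Neumann algebra it generates. *)
Definition group_vN : set (l2 R G -> l2 R G) :=
  commutant (commutant (range left_regular)).

Definition canonical_trace (x : l2 R G -> l2 R G) : R[i] :=
  hdot (delta 1%g) (x (delta 1%g)).

End group_von_Neumann_algebra.
Arguments group_vN R G : clear implicits.
Arguments canonical_trace R G : clear implicits.

(* A model of the GNS Hilbert space of (M, tau), unique up to a unitary: tau is
   extended to L^2(M, tau) by <x, y> = tau (x^* y), and [gns_map] is the
   canonical dense embedding of M. Only the values of [gns_map] on M matter. *)
Record gns {R : realType} {H : hilbertType R}
    (M : set (H -> H)) (tau : (H -> H) -> R[i]) := Gns {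
  gns_space :> hilbertType R ;
  gns_map : (H -> H) -> gns_space ;
  gns_linear : forall (z : R[i]) (x y : H -> H), M x -> M y ->
    gns_map (fun u => z *: x u + y u) = z *: gns_map x + gns_map y ;
  gns_dot : forall x y x' : H -> H, M x -> M y -> M x' -> adjoint_op x x' ->
    hdot (gns_map x) (gns_map y) = tau (x' \o y) ;
  gns_dense : closure (gns_map @` M) = [set: gns_space]
}.

Section dirichlet_forms.
Context {R : realType} {H : hilbertType R}.
Context {M : set (H -> H)} {tau : (H -> H) -> R[i]} (L2M : gns M tau).
Implicit Types (J : L2M -> L2M) (F : set L2M) (E : L2M -> R).

Definition antiunitary_star_extension J : Prop :=
  [/\ forall (z : R[i]) (a b : L2M), J (z *: a + b) = z^* *: J a + J b,
      forall a b, hdot (J a) (J b) = hdot b a,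
      (forall b, exists a, J a = b) &
      forall x x', M x -> M x' -> adjoint_op x x' ->
        J (gns_map L2M x) = gns_map L2M x'].

Definition L2_cone : set L2M :=
  closure (gns_map L2M @` [set x | M x /\ positive_op x]).

(* [gns_map L2M id] is the unit of M viewed in L^2(M, tau). *)
Definition below_one J : set L2M :=
  [set b | b = J b /\ L2_cone (gns_map L2M id - b)].

Definition is_projection (C : set L2M) (a b : L2M) : Prop :=
  C b /\ forall c, C c -> `|a - b| <= `|a - c|.

Definition linear_subspace F : Prop :=
  F 0 /\ forall (z : R[i]) (a b : L2M), F a -> F b -> F (z *: a + b).

Definition quadratic_form F E : Prop :=
  linear_subspace F /\ exists B : L2M -> L2M -> R[i],
    [/\ forall (z : R[i]) (a b c : L2M), F a -> F b -> F c ->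
          B a (z *: b + c) = z * B a b + B a c,
        forall (z : R[i]) (a b c : L2M), F a -> F b -> F c ->
          B (z *: b + c) a = z^* * B b a + B c a &
        forall a, F a -> B a a = (E a)%:C].

(* Completeness of F for the norm (|a|^2 + E[a])^(1/2). *)
Definition closed_form F E : Prop :=
  forall (u : nat -> L2M) (a : L2M), (forall n, F (u n)) ->
    u @ \oo --> a ->
    (forall e : R, 0 < e -> exists N : nat, forall m n : nat,
      (N <= m)%N -> (N <= n)%N -> E (u m - u n) < e) ->
    F a /\ (fun n => E (u n - a)) @ \oo --> (0 : R).

Definition real_form J F E : Prop :=
  forall a, F a -> F (J a) /\ E (J a) = E a.

(* b is the projection of a onto the closed convex set [below_one J], i.e. the
   vector a /\ 1 of L^2(M, tau); it exists and is unique. *)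
Definition markovian_form J F E : Prop :=
  forall a b, F a -> a = J a -> is_projection (below_one J) a b ->
    F b /\ E b <= E a.

(* Only the values of E on its domain F matter. *)
Definition dirichlet_form J F E : Prop :=
  [/\ [/\ quadratic_form F E, (forall a, F a -> 0 <= E a),
          closure F = [set: L2M] & closed_form F E],
      real_form J F E & markovian_form J F E].

End dirichlet_forms.

Section unbounded_operators.
Context {R : realType} {H : hilbertType R}.

(* Only the values of an operator on its domain matter. *)
Record operator := Operator { op_dom : set H ; op_fun :> H -> H }.

Implicit Types (L S : operator) (z w : R[i]).

Definition linear_operator L : Prop :=
  op_dom L 0 /\ forall z a b, op_dom L a -> op_dom L b ->
    op_dom L (z *: a + b) /\ L (z *: a + b) = z *: L a + L b.

Definition adjoint_graph L : set (H * H) :=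
  [set p | forall a, op_dom L a -> hdot (L a) p.1 = hdot a p.2].

Definition self_adjoint L : Prop :=
  [/\ linear_operator L, closure (op_dom L) = [set: H] &
      adjoint_graph L = [set p | op_dom L p.1 /\ p.2 = L p.1]].

Definition nonneg_operator L : Prop := forall a, op_dom L a -> 0 <= hdot a (L a).

Definition is_sqrt_operator S L : Prop :=
  [/\ self_adjoint S, nonneg_operator S,
      op_dom L = [set a | op_dom S a /\ op_dom S (S a)] &
      forall a, op_dom L a -> L a = S (S a)].

Definition resolvent_set L : set R[i] :=
  [set z | (forall b, exists! a, op_dom L a /\ L a - z *: a = b) /\
           exists c : R[i], forall a, op_dom L a -> `|a| <= c * `|L a - z *: a|].

Definition spectrum L : set R[i] := ~` resolvent_set L.

Definition eigenspace L z : set H := [set a | op_dom L a /\ L a = z *: a].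

Definition lin_indep n (v : 'I_n -> H) : Prop :=
  forall c : 'I_n -> R[i], \sum_i c i *: v i = 0 -> forall i, c i = 0.

(* +oo when W is infinite-dimensional. *)
Definition dimension (W : set H) : \bar R :=
  ereal_sup [set (n%:R)%:E | n in
    [set n | exists2 v : 'I_n -> H, lin_indep v & forall i, W (v i)]].

Definition discrete_spectrum L : Prop :=
  forall z, spectrum L z ->
    [/\ exists2 e : R, 0 < e &
          forall w, spectrum L w -> `|w - z| < e%:C -> w = z,
        exists2 a, a != 0 & eigenspace L z a &
        (dimension (eigenspace L z) < +oo)%E].

(* In the order of R[i], z <= x%:C forces z to be real. *)
Definition eigenvalue_count L (x : R) : \bar R :=
  \esum_(z in [set z | spectrum L z /\ z <= x%:C]) dimension (eigenspace L z).

Definition upper_spectral_dimension L : \bar R :=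
  ereal_inf [set d%:E | d in [set d : R | 0 < d /\
    (limf_esup (fun x => eigenvalue_count L x * ((x `^ d)^-1)%:E) +oo%R
      < +oo)%E]].

Definition associated_operator (F : set H) (E : H -> R) L : Prop :=
  [/\ self_adjoint L, nonneg_operator L &
      exists S, [/\ is_sqrt_operator S L, op_dom S = F &
        forall a, F a -> (E a)%:C = `|S a| ^+ 2]].

End unbounded_operators.

Section growth.
Context {G : groupType}.
Implicit Types (K : {fset G}) (n : nat).

Fixpoint pow_fset K n : {fset G} :=
  if n is m.+1 then [fset (s * t)%g | s in pow_fset K m, t in K]%fset
  else [fset 1%g]%fset.

Definition symmetric_fset K : Prop := forall g, g \in K -> (g^-1)%g \in K.

Definition generating_fset K : Prop :=
  forall S : set G, S 1%g -> (forall g h, S g -> S h -> S (g * h^-1)%g) ->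
    (forall g, g \in K -> S g) -> S = [set: G].

Definition polynomial_growth (R : realType) K : Prop :=
  exists c d : R, [/\ 0 < c, 0 < d & forall n, (1 <= n)%N ->
    #|` pow_fset K n|%:R <= c * n.+1%:R `^ d].

Definition homogeneous_dimension (R : realType) K : \bar R :=
  limn_esup (fun n => (ln #|` pow_fset K n|%:R / ln n%:R)%:E : \bar R).

End growth.

(* Main.v *)
(* Every finite set F gives the positive definite function
   phi_F(g) = |F ∩ gF| / |F| on G, which is finitely supported and satisfies
   phi_F(1) = 1; the multiplier T_F : lambda(g) |-> phi_F(g) lambda(g) commutes
   with J and preserves the unit and the positive cone of L^2, so that
   a |-> <a, (1 - T_F) a> is Markovian. Polynomial growth and the pigeonhole
   principle provide balls F_k = K^(N k) with N k <= 2^(k^2 + k) for large k and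
   1 - phi_k(s) <= 2^(-k^2) for s in K. Put
     l(g) = sum_k c_k (1 - phi_k(g)),    c_k = 2^(k (k - 1)).
   The function 1 - phi_k being subadditive, {g | l(g) < oo} is a subgroup; it
   contains K, so l is finite. The form E[a] = sum_g l(g) |a(g)|^2 is a sum of
   Markovian forms, its operator is multiplication by l, and its eigenvalues
   are the values of l. Since l >= c_k outside K^(2 N k), the number of g with
   l(g) <= x, where c_(k-1) <= x < c_k, is at most the cardinal of
   K^(2^(k^2 + k + 1)); it is O(x^d) for every d > d_h because the ratio of
   the exponents k^2 + k + 1 and (k - 1)(k - 2) tends to 1. *)

Require Import Defs.
From HB Require Import structures.
From mathcomp Require Import all_boot all_order all_algebra finmap.
From mathcomp Require Import complex.
From mathcomp Require Import mathcomp_extra boolp classical_sets functions.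
From mathcomp Require Import reals ereal topology normedtype.
From mathcomp Require Import ring lra zify.
From mathcomp Require Import cardinality fsbigop sequences esum exp.

Set Implicit Arguments.
Unset Strict Implicit.
Unset Printing Implicit Defensive.

Import Order.TTheory GRing.Theory Num.Theory.
Import numFieldNormedType.Exports.

Local Open Scope classical_set_scope.
Local Open Scope ring_scope.
Local Open Scope complex_scope.

Local Notation Re := complex.Re.

(** * Hilbert spaces *)

(** The order cone of [L^2] is in general not visible in the Fourier coefficients, so the Markov
    property cannot be read off the weight [l]. It enters only through multipliers, which have
    finitely supported symbols and therefore send the image of the von Neumann algebra into that of
    the group algebra, where positivity can be tested on finite matrices. Nor is it known beforehand
    that the projection of [a] lies in the domain: the Markov inequality is proved for the partial
    sums of [l], which give bounded forms, and membership in the domain comes out of the passage to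
    the limit. The constants come from the pigeonhole principle applied to [2^k] blocks of [2^(k^2)]
    radii each. The weight [c_k] is the reciprocal of the boundary ratio [2^(-k^2)] reduced by
    [2^k], which makes the series converge on [K]. The extra radius, the reduced weight and the gap
    between [c_(k-1)] and [c_k] all change the exponent of 2 by an amount linear in [k], negligible
    against [k^2]; hence no loss in the dimension. *)

Section complex_conjugation.
Context {R : realType}.

(* Restatements for [realType], on whose instances the lemmas for [rcfType] do
   not rewrite. *)
Lemma conj0 : (0 : R[i])^* = 0. Proof. exact: conjc0. Qed.

Lemma conj1 : (1 : R[i])^* = 1. Proof. exact: conjc1. Qed.

Lemma conj_real (x : R) : (x%:C)^* = x%:C. Proof. exact: conjc_real. Qed.

Lemma conj_realM (x : R) (z : R[i]) : (x%:C * z)^* = x%:C * z^*.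
Proof.
case: z => a b; apply/eqP; rewrite eq_complex /=.
by apply/andP; split; apply/eqP; ring.
Qed.

End complex_conjugation.

Section hilbert.
Context {R : realType} {H : hilbertType R}.
Implicit Types (a b c : H) (z : R[i]).

Definition sqn a : R := Re (hdot a a).

Lemma hdotDr a b c : hdot a (b + c) = hdot a b + hdot a c.
Proof. by have := hdotPr a 1 b c; rewrite scale1r mul1r. Qed.

Lemma hdot0r a : hdot a 0 = 0.
Proof. by apply: (addrI (hdot a 0)); rewrite -hdotDr !addr0. Qed.

Lemma hdotZr a z b : hdot a (z *: b) = z * hdot a b.
Proof. by have := hdotPr a z b 0; rewrite hdot0r !addr0. Qed.

Lemma hdotNr a b : hdot a (- b) = - hdot a b.
Proof. by rewrite -scaleN1r hdotZr mulN1r. Qed.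

Lemma hdotBr a b c : hdot a (b - c) = hdot a b - hdot a c.
Proof. by rewrite hdotDr hdotNr. Qed.

Lemma hdotDl a b c : hdot (a + b) c = hdot a c + hdot b c.
Proof. by rewrite hdotC hdotDr rmorphD/= -!hdotC. Qed.

Lemma hdotZl z a b : hdot (z *: a) b = z^* * hdot a b.
Proof. by rewrite hdotC hdotZr rmorphM/= -!hdotC. Qed.

Lemma hdot0l a : hdot 0 a = 0.
Proof. by rewrite hdotC hdot0r conj0. Qed.

Lemma hdotNl a b : hdot (- a) b = - hdot a b.
Proof. by rewrite hdotC hdotNr rmorphN/= -!hdotC. Qed.

Lemma hdotBl a b c : hdot (a - b) c = hdot a c - hdot b c.
Proof. by rewrite hdotDl hdotNl. Qed.

Lemma hdot_sumr a (I : Type) (s : seq I) (P : pred I) (f : I -> H) :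
  hdot a (\sum_(i <- s | P i) f i) = \sum_(i <- s | P i) hdot a (f i).
Proof.
by elim/big_rec2: _ => [|i x y _ <-]; rewrite ?hdot0r ?hdotDr.
Qed.

Lemma hdot_suml a (I : Type) (s : seq I) (P : pred I) (f : I -> H) :
  hdot (\sum_(i <- s | P i) f i) a = \sum_(i <- s | P i) hdot (f i) a.
Proof.
by elim/big_rec2: _ => [|i x y _ <-]; rewrite ?hdot0l ?hdotDl.
Qed.

Lemma Re_hdotC a b : Re (hdot a b) = Re (hdot b a).
Proof. by rewrite hdotC; case: (hdot b a). Qed.

Lemma normh_sqn a : `|a| ^+ 2 = (sqn a)%:C.
Proof.
rewrite -hdotxx /sqn; have := hdotC a a.
case: (hdot a a) => x y [] /eqP; rewrite -subr_eq0 opprK -mulr2n mulrn_eq0/=.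
by move=> /eqP ->.
Qed.

Lemma sqn_ge0 a : 0 <= sqn a.
Proof. by rewrite -lecR -normh_sqn exprn_ge0. Qed.

Lemma normhE a : `|a| = (Num.sqrt (sqn a))%:C.
Proof.
apply/eqP; rewrite -(eqrXn2 (ltn0Sn 1))//; last by rewrite lecR sqrtr_ge0.
by rewrite normh_sqn -rmorphXn/= sqr_sqrtr// sqn_ge0.
Qed.

Lemma hdotE a : hdot a a = (sqn a)%:C.
Proof. by rewrite hdotxx normh_sqn. Qed.

Lemma sqn_eq0 a : sqn a = 0 -> a = 0.
Proof. by move=> h; apply: normr0_eq0; rewrite normhE h sqrtr0. Qed.

Lemma sqn0 : sqn (0 : H) = 0.
Proof. by rewrite /sqn hdot0r. Qed.

Lemma sqnN a : sqn (- a) = sqn a.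
Proof. by rewrite /sqn hdotNl hdotNr opprK. Qed.

Lemma sqnBC a b : sqn (a - b) = sqn (b - a).
Proof. by rewrite -sqnN opprB. Qed.

Lemma sqnD a b : sqn (a + b) = sqn a + 2 * Re (hdot a b) + sqn b.
Proof.
rewrite /sqn hdotDl !hdotDr !raddfD/= (Re_hdotC b a); ring.
Qed.

Lemma sqnB a b : sqn (a - b) = sqn a - 2 * Re (hdot a b) + sqn b.
Proof. by rewrite sqnD hdotNr raddfN/= sqnN mulrN. Qed.

Lemma sqnZ z a : sqn (z *: a) = sqmod z * sqn a.
Proof.
rewrite /sqn hdotZl hdotZr hdotE; case: z => x y; rewrite /sqmod /=; ring.
Qed.

(** The parallelogram law with one term dropped. It stands in for the triangle inequality, so that
    estimates stay with real squared norms rather than norms in [R[i]]. *)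
Lemma sqnD_le a b : sqn (a + b) <= 2 * sqn a + 2 * sqn b.
Proof. by have := sqn_ge0 (a - b); rewrite sqnB sqnD; lra. Qed.

Lemma sqnB_le a b c : sqn (a - c) <= 2 * sqn (a - b) + 2 * sqn (b - c).
Proof. by have := sqnD_le (a - b) (b - c); rewrite addrA subrK. Qed.

Lemma hdot_CauchySchwarz a b : sqmod (hdot a b) <= sqn a * sqn b.
Proof.
have [->|b0] := eqVneq b 0.
  by rewrite hdot0r sqn0 mulr0 /sqmod /= expr0n/= addr0.
have sb : 0 < sqn b.
  by rewrite lt_def sqn_ge0 andbT; apply: contra b0 => /eqP/sqn_eq0 ->.
(* The component of [a] orthogonal to [b], multiplied by [|b|^2] to clear the denominator. *)
have := sqn_ge0 ((sqn b)%:C *: a - hdot b a *: b).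
rewrite sqnB !sqnZ hdotZl hdotZr (hdotC a b).
case: (hdot b a) => x y; rewrite /sqmod /= => h.
suff : 0 <= sqn b * (sqn a * sqn b - (x ^+ 2 + (- y) ^+ 2)).
  by rewrite pmulr_rge0// subr_ge0.
by apply: le_trans h _; rewrite le_eqVlt; apply/orP; left; apply/eqP; ring.
Qed.

Lemma closure_sqnP (A : set H) a :
  closure A a <-> forall e : R, 0 < e -> exists2 b, A b & sqn (a - b) < e.
Proof.
split=> [cA e e0|h B /= /nbhs_ballP[_ /= /pos_complexP[e e0 ->]] eB].
  have se : 0 < (Num.sqrt e)%:C by rewrite ltcR sqrtr_gt0.
  have [b [Ab]] := cA _ (nbhsx_ballx a _ se).
  rewrite -ball_normE /ball_ /= normhE ltcR => h; exists b => //.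
  by rewrite -(ltr_sqrt _ e0).
have [|b Ab ab] := h (e ^+ 2); first by rewrite exprn_gt0.
exists b; split=> //; apply: eB; rewrite -ball_normE /ball_ /= normhE ltcR.
rewrite -[ltRHS](gtr0_norm e0) -sqrtr_sqr ltr_sqrt// exprn_gt0//.
Qed.

Lemma cvg_sqnP (u : nat -> H) a : u @ \oo --> a <->
  forall e : R, 0 < e -> exists N, forall n, (N <= n)%N -> sqn (u n - a) < e.
Proof.
split=> [/cvgrPdist_lt ua e e0|h].
  have se : 0 < (Num.sqrt e)%:C by rewrite ltcR sqrtr_gt0.
  have [N _ Nu] := ua _ se; exists N => n /Nu /=.
  by rewrite normhE ltcR sqnBC ltr_sqrt.
apply/cvgrPdist_lt => _ /pos_complexP[e e0 ->].
have [|N hN] := h (e ^+ 2); first by rewrite exprn_gt0.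
exists N => // n /hN /= {}hN; rewrite normhE ltcR sqnBC.
by rewrite -[ltRHS](gtr0_norm e0) -sqrtr_sqr ltr_sqrt// exprn_gt0.
Qed.

Lemma cauchy_sqn (u : nat -> H) :
  (forall e : R, 0 < e -> exists N, forall m n, (N <= m)%N -> (N <= n)%N ->
     sqn (u m - u n) < e) -> exists a, u @ \oo --> a.
Proof.
move=> h; apply/cvg_ex/cauchy_cvgP/cauchy_ballP => _ /pos_complexP[e e0 ->].
have [|N hN] := h (e ^+ 2); first by rewrite exprn_gt0.
pose A := u @` [set n | (N <= n)%N].
exists (A, A) => [|[_ _] [/= [m Nm <-] [n Nn <-]]].
  by split; exists N => // n Nn /=; exists n.
rewrite -ball_normE /ball_ /= normhE ltcR.
rewrite -[ltRHS](gtr0_norm e0) -sqrtr_sqr ltr_sqrt ?exprn_gt0//.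
exact: hN.
Qed.

End hilbert.

(** * Bounded operators and finitely supported vectors *)

Section raw_linear.
Context {A : pzRingType} {V W : lmodType A} (f : V -> W) (lf : linear f).

Lemma lin0 : f 0 = 0.
Proof. by have := lf (-1) 0 0; rewrite !scaleN1r !addNr. Qed.

Lemma linD a b : f (a + b) = f a + f b.
Proof. by have := lf 1 a b; rewrite !scale1r. Qed.

Lemma linZ z a : f (z *: a) = z *: f a.
Proof. by have := lf z a 0; rewrite lin0 !addr0. Qed.

Lemma linN a : f (- a) = - f a.
Proof. by rewrite -scaleN1r linZ scaleN1r. Qed.

Lemma linB a b : f (a - b) = f a - f b.
Proof. by rewrite linD linN. Qed.

Lemma lin_sum (I : Type) (s : seq I) (P : pred I) (F : I -> V) :
  f (\sum_(i <- s | P i) F i) = \sum_(i <- s | P i) f (F i).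
Proof. by elim/big_rec2: _ => [|i x y _ <-]; rewrite ?lin0 ?linD. Qed.

End raw_linear.

Section bounded_operators.
Context {R : realType} {H : hilbertType R}.
Implicit Types (x y : H -> H).

Lemma bounded_opP x : bounded_op x <->
  linear x /\ exists2 C : R, 0 <= C & forall u, sqn (x u) <= C * sqn u.
Proof.
split=> [[lx cx]|[lx [C C0 xC]]]; split=> //.
- pose Fx := GRing.isLinear.Build _ _ _ _ x lx.
  pose fx : {linear H -> H} := HB.pack x Fx.
  have /cvgrPdist_lt/(_ 1 ltr01) := cx 0.
  have x0 : x 0 = 0 by exact: lin0.
  rewrite x0; case/nbhs_ballP => _ /pos_complexP[d d0 ->] dx.
  (* Rescaled to norm [d / 2], a nonzero [u] lies in the ball that [x] maps into the unit ball;
     squaring gives this constant. *)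
  exists (4 / d ^+ 2) => [|u]; first by rewrite divr_ge0// exprn_ge0 ?ltW.
  have [u0|u0] := eqVneq (sqn u) 0.
    have -> : u = 0 by exact: sqn_eq0.
    by rewrite x0 sqn0 mulr0.
  have su : 0 < Num.sqrt (sqn u) by rewrite sqrtr_gt0 lt_def u0 sqn_ge0.
  pose t := d / (2 * Num.sqrt (sqn u)).
  have t0 : 0 < t by rewrite divr_gt0 ?mulr_gt0.
  have tE : t ^+ 2 * sqn u = d ^+ 2 / 4.
    rewrite -[sqn u]sqr_sqrtr ?sqn_ge0// /t; field.
    by rewrite gt_eqF.
  have sz : sqmod (t%:C) = t ^+ 2 by rewrite /sqmod /= expr0n addr0.
  have /dx : ball (0 : H) d%:C (t%:C *: u).
    rewrite -ball_normE /ball_ /= sub0r normrN normhE ltcR sqnZ sz tE.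
    rewrite -[ltRHS](gtr0_norm d0) -sqrtr_sqr ltr_sqrt ?exprn_gt0//.
    by have := exprn_gt0 2 d0; lra.
  rewrite /= sub0r normrN normhE ltcR (linZ lx) sqnZ sz.
  rewrite -[ltRHS]sqrtr1 ltr_sqrt// => h.
  have d20 : 0 < d ^+ 2 by rewrite exprn_gt0.
  rewrite mulrAC ler_pdivlMr//.
  have -> : d ^+ 2 = 4 * (t ^+ 2 * sqn u) by rewrite tE; field.
  have su2 : 0 <= 4 * sqn u by rewrite mulr_ge0 ?sqn_ge0.
  have -> : sqn (x u) * (4 * (t ^+ 2 * sqn u)) =
    (4 * sqn u) * (t ^+ 2 * sqn (x u)) by ring.
  by rewrite -[leRHS]mulr1 ler_wpM2l// ltW.
- move=> u; apply/cvgrPdist_lt => _ /pos_complexP[e e0 ->].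
  have d0 : 0 < e ^+ 2 / (C + 1) by rewrite divr_gt0 ?exprn_gt0// ltr_wpDl.
  apply/nbhs_ballP; exists (Num.sqrt (e ^+ 2 / (C + 1)))%:C => /=.
    by rewrite ltcR sqrtr_gt0.
  move=> v; rewrite -ball_normE /ball_ /= !normhE !ltcR ltr_sqrt// => h.
  rewrite -[ltRHS](gtr0_norm e0) -sqrtr_sqr ltr_sqrt ?exprn_gt0//.
  rewrite -(linB lx).
  apply: le_lt_trans (xC _) _.
  move: h; rewrite ltr_pdivlMr ?ltr_wpDl//; apply: le_lt_trans.
  by rewrite mulrC ler_wpM2l ?sqn_ge0// lerDl.
Qed.

End bounded_operators.

Section l2_finite_support.
Context {R : realType} {T : choiceType}.
Implicit Types (x y : l2 R T) (s : seq T).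

Lemma l2_ext x y : (forall i, x i = y i) -> x = y.
Proof. by move=> h; apply/val_inj/funext. Qed.

Lemma sqn_l2 x : sqn x = l2_sqnorm x.
Proof. by rewrite /sqn (_ : hdot x x = l2_dot x x)// l2_dotxx. Qed.

Lemma ler_sum_support (f : T -> R) r s : uniq r -> uniq s ->
  (forall i, 0 <= f i) -> (forall i, i \notin s -> f i = 0) ->
  \sum_(i <- r) f i <= \sum_(i <- s) f i.
Proof.
move=> ur us f0 fs.
rewrite (bigID (mem s))/= [X in _ + X]big1 ?addr0//.
rewrite [leRHS](bigID (mem r))/= -(big_filter r) -(big_filter s (mem r)).
rewrite (perm_big [seq i <- s | i \in r])/= ?lerDl ?sumr_ge0//.
by rewrite uniq_perm ?filter_uniq// => i; rewrite !mem_filter andbC.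
Qed.

Lemma rsummable_fin_support (f : T -> R) s :
  (forall i, i \notin s -> f i = 0) -> rsummable f.
Proof.
move=> fs; pose M := \sum_(i <- undup s) `|f i|.
have := @rsum_le_fset R T (fun i => `|f i|) M (fun=> normr_ge0 _).
case=> [r ur|]; last first.
  by rewrite /rsummable; under eq_esum do rewrite normr_id.
apply: ler_sum_support; rewrite ?undup_uniq// => i.
by rewrite mem_undup => /fs ->; rewrite normr0.
Qed.

Lemma rsum_fin_support (f : T -> R) s : uniq s ->
  (forall i, i \notin s -> f i = 0) -> rsum f = \sum_(i <- s) f i.
Proof.
move=> us fs; wlog f0 : f fs / forall i, 0 <= f i => [hw|].
  have m0 (x : R) : 0 <= Num.max x 0 by rewrite le_max lexx orbT.
  rewrite rsumE !hw// => [|i /fs ->|i /fs ->]; rewrite ?oppr0 ?maxxx//.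
  rewrite -sumrB; apply: eq_bigr => i _.
  by case: (leP (f i)); case: (leP (- f i)); lra.
have sf := rsummable_fin_support fs.
apply/le_anti/andP; split; last exact: rsum_ge_seq.
have [//|r ur|//] := @rsum_le_fset R T f (\sum_(i <- s) f i).
exact: ler_sum_support.
Qed.

Lemma csum_fin_support (f : T -> R[i]) s : uniq s ->
  (forall i, i \notin s -> f i = 0) -> csum f = \sum_(i <- s) f i.
Proof.
move=> us fs; rewrite /csum !(@rsum_fin_support _ s)// => [|i /fs ->|i /fs ->] //.
by apply/eqP; rewrite eq_complex /= !raddf_sum !eqxx.
Qed.

Lemma fin_l2_subproof s (f : T -> R[i]) :
  (fun i => if i \in s then f i else 0) \in l2_pred.
Proof.
apply/asboolP/(@rsummable_fin_support _ s) => i /negbTE ->.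
by rewrite /sqmod /= expr0n addr0.
Qed.

Definition fin_l2 s f : l2 R T := L2 (fin_l2_subproof s f).

Lemma hdot_l2E x y : hdot x y = csum (fun i => (x i)^* * y i).
Proof. by []. Qed.

Lemma hdot_fin_l2 s f y : uniq s ->
  hdot (fin_l2 s f) y = \sum_(i <- s) (f i)^* * y i.
Proof.
move=> us; rewrite hdot_l2E (csum_fin_support us) => [|i /negbTE is0].
  by rewrite !big_seq; apply: eq_bigr => i /= ->.
by rewrite /= is0 [X in X * _]conj0 mul0r.
Qed.

Lemma sqn_fin_l2 s f : uniq s -> sqn (fin_l2 s f) = \sum_(i <- s) sqmod (f i).
Proof.
move=> us; rewrite sqn_l2 /l2_sqnorm (rsum_fin_support us) => [|i /negbTE is0].
  by rewrite !big_seq; apply: eq_bigr => i /= ->.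
by rewrite /= is0 /sqmod /= expr0n addr0.
Qed.

Lemma sum_sqmod_le x s : uniq s -> \sum_(i <- s) sqmod (x i) <= sqn x.
Proof.
move=> us; rewrite sqn_l2.
apply: (@rsum_ge_seq _ _ (fun i => sqmod (x i))) => //; last exact: l2_sq.
by move=> i; exact: sqmod_ge0.
Qed.

Lemma sqn_sub_fin_l2 x s : uniq s ->
  sqn (x - fin_l2 s x) = sqn x - \sum_(i <- s) sqmod (x i).
Proof.
move=> us; rewrite sqnBC sqnB hdot_fin_l2// sqn_fin_l2// raddf_sum/=.
have -> : \sum_(i <- s) Re ((x i)^* * x i) = \sum_(i <- s) sqmod (x i).
  by apply: eq_bigr => i _; case: (x i) => a b; rewrite /sqmod /=; ring.
ring.
Qed.

(** If every truncation left an error of at least [e], all finite sums of the squared coordinates,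
    hence also their total, would be at most [|x|^2 - e]. *)
Lemma fin_l2_approx x (e : R) : 0 < e ->
  exists2 s, uniq s & sqn (x - fin_l2 s x) < e.
Proof.
move=> e0; pose f i := sqmod (x i).
have f0 i : 0 <= f i by exact: sqmod_ge0.
apply: contrapT => h.
have [|_] := @rsum_le_fset _ _ f (sqn x - e) f0.
  move=> s us; rewrite lerBrDr -lerBrDl -sqn_sub_fin_l2// leNgt.
  by apply/negP => es; apply: h; exists s.
have -> : rsum f = sqn x by rewrite sqn_l2.
by rewrite lerBrDr gerDl leNgt e0.
Qed.

End l2_finite_support.

Section l2_group_operators.
Context {R : realType} {G : groupType}.
Implicit Types (u v : l2 R G) (x : l2 R G -> l2 R G).

Lemma deltaE (g h : G) : delta g h = (h == g)%:R :> R[i].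
Proof. by []. Qed.

Lemma hdot_delta (g : G) u : hdot (delta g) u = u g.
Proof.
rewrite hdot_l2E (@csum_fin_support _ _ _ [:: g])//= => [|h].
  by rewrite big_seq1 eqxx [X in X * _]conj1 mul1r.
by rewrite inE => /negbTE ->; rewrite [X in X * _]conj0 mul0r.
Qed.

Lemma fin_l2_delta (s : seq G) (f : G -> R[i]) : uniq s ->
  fin_l2 s f = \sum_(g <- s) f g *: delta g.
Proof.
move=> us; apply: l2_ext => h; rewrite -[RHS]hdot_delta hdot_sumr/=.
under eq_bigr do rewrite hdotZr hdot_delta deltaE.
case: ifPn => hs.
  rewrite (bigD1_seq h)//= eqxx mulr1 big1 ?addr0// => g gh.
  by rewrite eq_sym (negbTE gh) mulr0.
rewrite big_seq big1// => g gs; case: eqP => [hg|]; last by rewrite mulr0.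
by rewrite hg gs in hs.
Qed.

End l2_group_operators.

(** * The group von Neumann algebra *)

(** The limiting step of the density arguments: a nonnegative squared error bounded by a fixed
    multiple of every positive [e] vanishes. *)
Lemma le0_arbitrarily_small (R : realType) (t k : R) : 0 <= k ->
  (forall e : R, 0 < e -> t <= k * e) -> t <= 0.
Proof.
move=> k0 h; apply/ler_addgt0Pr => e e0; rewrite add0r.
have k1 : 0 < k + 1 by rewrite ltr_wpDl.
apply: le_trans (h (e / (k + 1)) _) _; first exact: divr_gt0.
by rewrite mulrA ler_pdivrMr// mulrC ler_pM2l// lerDl.
Qed.

Lemma sqmodB_le (R : realType) (z w : R[i]) :
  sqmod (z - w) <= 2 * sqmod z + 2 * sqmod w.
Proof.
case: z w => [a b] [c d]; rewrite /sqmod /=.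
by have := sqr_ge0 (a + c); have := sqr_ge0 (b + d); nra.
Qed.

Section adjoints.
Context {R : realType} {H : hilbertType R}.
Implicit Types (x y : H -> H).

Lemma hdot_inj (a b : H) : (forall u, hdot u a = hdot u b) -> a = b.
Proof.
move=> h; apply/subr0_eq/sqn_eq0.
by rewrite /sqn hdotBr (h (a - b)) subrr.
Qed.

Lemma adjoint_opC x y : adjoint_op x y -> adjoint_op y x.
Proof. by move=> xy u v; rewrite hdotC -xy -hdotC. Qed.

End adjoints.

Section group_vN_theory.
Context {R : realType} {G : groupType}.
Implicit Types (u v : l2 R G) (x y : l2 R G -> l2 R G).

Lemma rsum_reindex (f : G -> R) (p q : G -> G) : cancel p q -> cancel q p ->
  rsum (f \o p) = rsum f.
Proof.
move=> pq qp; rewrite /rsum.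
have pb : set_bij [set: G] [set: G] p.
  by split=> // [g h _ _ /(can_inj pq)//|g _]; exists (q g).
by congr (fine _ - fine _); symmetry; exact: reindex_esum pb.
Qed.

Lemma left_regularE (g : G) u h : left_regular g u h = u (g^-1 * h)%g.
Proof. by []. Qed.

Lemma sqn_left_regular (g : G) u : sqn (left_regular g u) = sqn u.
Proof.
rewrite !sqn_l2 /l2_sqnorm.
exact: (@rsum_reindex (fun h => sqmod (u h)) _ _ (mulVKg g) (mulKg g)).
Qed.

Lemma left_regular_bounded (g : G) : bounded_op (@left_regular R G g).
Proof.
apply/bounded_opP; split; first by move=> z u v; apply: l2_ext.
by exists 1 => // u; rewrite sqn_left_regular mul1r.
Qed.

Lemma left_regular_delta (g h : G) :
  left_regular g (delta h) = delta (g * h)%g :> l2 R G.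
Proof.
apply: l2_ext => k; rewrite left_regularE !deltaE.
by rewrite -(inj_eq (mulgI g)) mulVKg.
Qed.

Lemma left_regular_adjoint (g : G) :
  adjoint_op (@left_regular R G g) (left_regular g^-1).
Proof.
move=> u v; rewrite !hdot_l2E /csum.
by congr (_ +i* _); rewrite -[RHS](@rsum_reindex _ _ _ (mulVKg g) (mulKg g));
  congr rsum; apply/funext => h /=; rewrite invgK mulVKg.
Qed.

Lemma right_regular_subproof (g : G) u : (fun h => u (h * g)%g) \in l2_pred.
Proof.
apply/asboolP; have := l2_sq u; rewrite /rsummable.
rewrite (reindex_esum [set: G] [set: G] (fun h => (h * g)%g))//.
split=> // [h k _ _|h _] /=; first exact: mulIg.
by exists (h * g^-1)%g => //=; rewrite mulgVK.
Qed.

Definition right_regular (g : G) u : l2 R G := L2 (right_regular_subproof g u).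

Lemma right_regular_commutant (g : G) :
  commutant (range (@left_regular R G)) (right_regular g).
Proof.
split.
  apply/bounded_opP; split; first by move=> z u v; apply: l2_ext.
  exists 1 => // u; rewrite mul1r !sqn_l2 /l2_sqnorm.
  rewrite -[in leRHS](@rsum_reindex _ _ _ (mulgK g) (mulgVK g))//.
by move=> _ [h _ <-]; apply/funext => u; apply: l2_ext => k /=; rewrite mulgA.
Qed.

(** [x] commutes with right translations and [delta h] is a right translate of [delta 1]. The matrix
    of [x] thus depends only on [k * h^-1], and [x] is determined by [x (delta 1)]. *)
Lemma group_vN_delta x (h k : G) : group_vN R G x ->
  x (delta h) k = x (delta 1%g) (k * h^-1)%g.
Proof.
move=> [_ /(_ _ (right_regular_commutant h^-1%g)) /(congr1 (@^~ (delta 1%g)))].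
move=> /= xr; have -> : x (delta 1%g) (k * h^-1)%g =
  right_regular h^-1%g (x (delta 1%g)) k by [].
rewrite -xr; congr (x _ k); apply: l2_ext => g /=.
by rewrite -[RHS]/((g * h^-1 == 1)%g%:R) -(inj_eq (mulIg h) (g * h^-1)%g) mulgVK
  mul1g.
Qed.

Lemma group_vN_left_regular (g : G) : group_vN R G (left_regular g).
Proof.
split; first exact: left_regular_bounded.
by move=> y [_ /(_ (left_regular g))] ->//; exists g.
Qed.

Lemma group_vN_linear (z : R[i]) x y : group_vN R G x -> group_vN R G y ->
  group_vN R G (fun u => z *: x u + y u).
Proof.
move=> [/bounded_opP[lx [C C0 xC]] cx] [/bounded_opP[ly [D D0 yD]] cy].
split=> [|w wc].
  apply/bounded_opP; split.
    move=> a u v; rewrite lx ly !scalerDr !scalerA mulrC addrACA.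
    by rewrite -!scalerA.
  exists (2 * (sqmod z * C) + 2 * D) => [|u].
    by rewrite addr_ge0// mulr_ge0// mulr_ge0// sqmod_ge0.
  apply: le_trans (sqnD_le _ _) _; rewrite sqnZ.
  by have := ler_wpM2l (sqmod_ge0 z) (xC u); have := yD u; lra.
have lw : linear w := wc.1.1.
have := cx _ wc; have := cy _ wc => yw xw.
apply/funext => u /=; rewrite lw.
by have /= -> := congr1 (@^~ u) xw; have /= -> := congr1 (@^~ u) yw.
Qed.

Definition convolution (s : seq G) (f : G -> R[i]) u : l2 R G :=
  \sum_(g <- s) f g *: left_regular g u.

Lemma group_vN_convolution s f : group_vN R G (convolution s f).
Proof.
elim: s => [|g s ih].
  (* The zero operator, obtained as a linear combination of the identity with itself. *)
  have := group_vN_linear (-1) (group_vN_left_regular 1)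
    (group_vN_left_regular 1).
  congr (group_vN R G); apply/funext => u.
  by rewrite /convolution big_nil scaleN1r addNr.
have := group_vN_linear (f g) (group_vN_left_regular g) ih.
by congr (group_vN R G); apply/funext => u; rewrite /convolution big_cons.
Qed.

(** The adjoint is built by coordinates, [(x' v) g = <x (delta g), v>]. This is square summable by
    duality with finitely supported vectors, on which the adjoint relation holds by construction;
    density extends it. *)
Lemma bounded_adjoint x : bounded_op x ->
  exists2 x' : l2 R G -> l2 R G, bounded_op x' & adjoint_op x x'.
Proof.
move=> /bounded_opP[lx [C C0 xC]].
have bnd v s : uniq s ->
    \sum_(g <- s) sqmod (hdot (x (delta g)) v) <= C * sqn v.
  move=> us; pose f g := hdot (x (delta g)) v.
  have wE : x (fin_l2 s f) = \sum_(g <- s) f g *: x (delta g).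
    rewrite fin_l2_delta// (lin_sum lx); apply: eq_bigr => g _.
    exact: linZ.
  (* With [w] the truncation to [s] of the future [x' v], [<v, x w> = |w|^2]; Cauchy-Schwarz gives
     [|w|^4 <= |v|^2 * C * |w|^2], and one factor [|w|^2] cancels. *)
  have := hdot_CauchySchwarz v (x (fin_l2 s f)).
  have -> : hdot v (x (fin_l2 s f)) = (sqn (fin_l2 s f))%:C.
    rewrite wE sqn_fin_l2// rmorph_sum hdot_sumr; apply: eq_bigr => g _.
    rewrite hdotZr (hdotC v) -/(f g); case: (f g) => a b.
    by apply/eqP; rewrite eq_complex /sqmod /=; apply/andP; split;
      apply/eqP; ring.
  rewrite -sqn_fin_l2//; set A := sqn (fin_l2 s f) => AC.
  have A0 : 0 <= A by exact: sqn_ge0.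
  have [->|An0] := eqVneq A 0; first by rewrite mulr_ge0 ?sqn_ge0.
  have Ap : 0 < A by rewrite lt_def An0.
  rewrite -(ler_pM2l Ap); move: AC; rewrite {1}/sqmod /= expr0n addr0 expr2.
  move=> /le_trans; apply; have := ler_wpM2l (sqn_ge0 v) (xC (fin_l2 s f)).
  by rewrite -/A => /le_trans; apply; rewrite le_eqVlt; apply/orP; left;
    apply/eqP; ring.
have sm v := rsum_le_fset (fun g => sqmod_ge0 (hdot (x (delta g)) v)) (bnd v).
have mem v : (fun g => hdot (x (delta g)) v) \in l2_pred.
  by apply/asboolP; have [] := sm v.
pose x' v : l2 R G := L2 (mem v).
have x'C v : sqn (x' v) <= C * sqn v by rewrite sqn_l2; have [] := sm v.
exists x'.
  apply/bounded_opP; split; last by exists C.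
  by move=> z u v; apply: l2_ext => g /=; rewrite hdotPr.
move=> u v; apply/subr0_eq/sqmod_eq0/le_anti; rewrite sqmod_ge0 andbT.
apply: (@le0_arbitrarily_small _ _ (4 * (C * sqn v))).
  by rewrite !mulr_ge0 ?sqn_ge0.
move=> e e0; have [s us se] := fin_l2_approx u e0.
have fE : hdot (x (fin_l2 s u)) v = hdot (fin_l2 s u) (x' v).
  rewrite hdot_fin_l2// fin_l2_delta// (lin_sum lx) hdot_suml.
  by apply: eq_bigr => g _; rewrite (linZ lx) hdotZl.
have -> : hdot (x u) v - hdot u (x' v) =
    hdot (x (u - fin_l2 s u)) v - hdot (u - fin_l2 s u) (x' v).
  by rewrite (linB lx) !hdotBl fE; ring.
set d := u - fin_l2 s u in se *.
apply: le_trans (sqmodB_le _ _) _.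
have h1 : sqmod (hdot (x d) v) <= C * sqn v * sqn d.
  apply: le_trans (hdot_CauchySchwarz _ _) _; rewrite mulrAC.
  by rewrite ler_wpM2r// sqn_ge0.
have h2 : sqmod (hdot d (x' v)) <= C * sqn v * sqn d.
  apply: le_trans (hdot_CauchySchwarz _ _) _; rewrite [leRHS]mulrC.
  by rewrite ler_wpM2l// sqn_ge0.
have h3 : C * sqn v * sqn d <= C * sqn v * e.
  by rewrite ler_wpM2l ?mulr_ge0 ?sqn_ge0// ltW.
lra.
Qed.

(** Taking adjoints in [x y' = y' x] gives the commutation of [x'] with [y]. Used twice, it carries
    stability under adjoints from the left translations to their bicommutant. *)
Lemma commutant_adjoint (S : set (l2 R G -> l2 R G)) x x' :
  (forall y, S y -> exists2 y', S y' & adjoint_op y y') ->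
  bounded_op x' -> adjoint_op x x' -> commutant S x -> commutant S x'.
Proof.
move=> Sadj bx' xx' [bx cx]; split=> // y Sy.
have [y' Sy' yy'] := Sadj _ Sy; apply/funext => v /=.
apply: hdot_inj => u; rewrite -xx' -!(adjoint_opC yy') -xx'.
by have /= -> := congr1 (@^~ u) (cx _ Sy').
Qed.

Lemma group_vN_adjoint x : group_vN R G x ->
  exists2 x', group_vN R G x' & adjoint_op x x'.
Proof.
move=> Mx; have [x' bx' xx'] := bounded_adjoint Mx.1.
exists x' => //; apply: commutant_adjoint bx' xx' Mx => y cy.
have [y' by' yy'] := bounded_adjoint cy.1.
exists y' => //; apply: commutant_adjoint by' yy' cy => _ [g _ <-].
exists (left_regular g^-1); first by exists g^-1%g.
exact: left_regular_adjoint.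
Qed.

End group_vN_theory.

(** * Fourier coefficients on the GNS space *)

Lemma ge0_complex_closed (R : realType) (z : R[i]) :
  (forall e : R, 0 < e -> exists2 w : R[i], 0 <= w & sqmod (z - w) < e) ->
  0 <= z.
Proof.
case: z => a b h; rewrite lecE /=.
have {}h e : 0 < e -> exists2 c : R, 0 <= c & (a - c) ^+ 2 + b ^+ 2 < e.
  move=> /h[[c d]]; rewrite lecE /= => /andP[/eqP -> c0].
  by rewrite /sqmod /= subr0; exists c.
apply/andP; split.
  rewrite -sqrf_eq0 eq_le sqr_ge0 andbT.
  apply: (@le0_arbitrarily_small _ _ 1) => // e /h[c _].
  by have := sqr_ge0 (a - c); lra.
rewrite leNgt; apply/negP => a0.
have [|c c0] := h (a ^+ 2); first by rewrite exprn_even_gt0//= lt_eqF.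
by have := sqr_ge0 b; have := sqr_ge0 c; nra.
Qed.

Section gns_model.
Context {R : realType} {G : groupType}.
Variable L2G : gns (group_vN R G) (canonical_trace R G).
Implicit Types (a b : L2G) (x y : l2 R G -> l2 R G) (g h : G).

(** The trace is the vector state of [delta 1], so [x |-> x (delta 1)] has the same inner products
    as [gns_map]. This is the source of the identification of the abstract GNS space with
    [l2(G)]. *)
Lemma gns_hdot x y : group_vN R G x -> group_vN R G y ->
  hdot (gns_map L2G x) (gns_map L2G y) = hdot (x (delta 1%g)) (y (delta 1%g)).
Proof.
move=> Mx My; have [x' Mx' xx'] := group_vN_adjoint Mx.
by rewrite (gns_dot L2G Mx My Mx' xx') /canonical_trace/= xx'.
Qed.

Definition gns_basis g : L2G := gns_map L2G (left_regular g).

Lemma gns_basisE g : left_regular g (delta 1%g) = delta g :> l2 R G.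
Proof. by rewrite left_regular_delta mulg1. Qed.

Lemma gns_basis_dot g h :
  hdot (gns_basis g) (gns_basis h) = (g == h)%:R :> R[i].
Proof.
rewrite gns_hdot; try exact: group_vN_left_regular.
by rewrite !gns_basisE hdot_delta deltaE.
Qed.

Lemma gns_Bessel a (s : seq G) : uniq s ->
  \sum_(g <- s) sqmod (hdot (gns_basis g) a) <= sqn a.
Proof.
move=> us; pose c g := hdot (gns_basis g) a.
pose p := \sum_(g <- s) c g *: gns_basis g.
have cp g : g \in s -> hdot (gns_basis g) p = c g.
  move=> gs; rewrite hdot_sumr (bigD1_seq g)//= hdotZr gns_basis_dot eqxx mulr1.
  rewrite big1 ?addr0// => h hg.
  by rewrite hdotZr gns_basis_dot eq_sym (negbTE hg) mulr0.
have sumE b : (forall g, g \in s -> hdot (gns_basis g) b = c g) ->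
    hdot p b = (\sum_(g <- s) sqmod (c g))%:C.
  move=> cb; rewrite hdot_suml rmorph_sum !big_seq; apply: eq_bigr => g gs.
  rewrite hdotZl cb//; case: (c g) => u v.
  by apply/eqP; rewrite eq_complex /sqmod /=; apply/andP; split;
      apply/eqP; ring.
have := sqn_ge0 (p - a); rewrite sqnB {1}/sqn.
by rewrite (sumE p cp) (sumE a (fun _ _ => erefl))/=; lra.
Qed.

Lemma gns_coord_subproof a : (fun g => hdot (gns_basis g) a) \in l2_pred.
Proof.
apply/asboolP.
by have [] := rsum_le_fset (fun g => sqmod_ge0 (hdot (gns_basis g) a))
  (@gns_Bessel a).
Qed.

Definition gns_coord a : l2 R G := L2 (gns_coord_subproof a).

Lemma gns_coordE a g : gns_coord a g = hdot (gns_basis g) a.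
Proof. by []. Qed.

Lemma gns_coord_linear : linear gns_coord.
Proof. by move=> z a b; apply: l2_ext => g; rewrite gns_coordE hdotPr. Qed.

Lemma sqn_gns_coord_le a : sqn (gns_coord a) <= sqn a.
Proof.
rewrite sqn_l2.
by have [] := rsum_le_fset (fun g => sqmod_ge0 (hdot (gns_basis g) a))
  (@gns_Bessel a).
Qed.

Lemma gns_coord_map x : group_vN R G x ->
  gns_coord (gns_map L2G x) = x (delta 1%g).
Proof.
move=> Mx; apply: l2_ext => g; rewrite gns_coordE gns_hdot//.
  by rewrite gns_basisE hdot_delta.
exact: group_vN_left_regular.
Qed.

Lemma gns_denseP a (e : R) : 0 < e ->
  exists2 x, group_vN R G x & sqn (a - gns_map L2G x) < e.
Proof.
have : [set: L2G] a by [].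
rewrite -gns_dense => /closure_sqnP h /h[_ [x Mx <-] ax].
by exists x.
Qed.

(** Parseval: the defect [D] is sesquilinear and bounded and vanishes on the image of the algebra.
    Density of this image is used in one variable at a time. *)
Lemma gns_coord_dot a b : hdot (gns_coord a) (gns_coord b) = hdot a b.
Proof.
pose D a b := hdot (gns_coord a) (gns_coord b) - hdot a b.
have Db a1 b1 : sqmod (D a1 b1) <= 4 * (sqn a1 * sqn b1).
  apply: le_trans (sqmodB_le _ _) _.
  have := hdot_CauchySchwarz a1 b1.
  have := hdot_CauchySchwarz (gns_coord a1) (gns_coord b1).
  have := ler_pM (sqn_ge0 _) (sqn_ge0 _) (sqn_gns_coord_le a1)
    (sqn_gns_coord_le b1).
  lra.
have DBl a1 a2 b1 : D (a1 - a2) b1 = D a1 b1 - D a2 b1.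
  by rewrite /D (linB gns_coord_linear) !hdotBl; ring.
have DBr a1 b1 b2 : D a1 (b1 - b2) = D a1 b1 - D a1 b2.
  by rewrite /D (linB gns_coord_linear) !hdotBr; ring.
suff D0 a1 b1 : D a1 b1 = 0 by apply/subr0_eq/D0.
have Mb x b2 : group_vN R G x -> D (gns_map L2G x) b2 = 0.
  move=> Mx; apply/sqmod_eq0/le_anti; rewrite sqmod_ge0 andbT.
  apply: (@le0_arbitrarily_small _ _ (4 * sqn (gns_map L2G x))).
    by rewrite mulr_ge0 ?sqn_ge0.
  move=> e /(gns_denseP b2)[y My ye].
  have -> : D (gns_map L2G x) b2 = D (gns_map L2G x) (b2 - gns_map L2G y).
    by rewrite DBr {3}/D !gns_coord_map// gns_hdot// subrr subr0.
  apply: le_trans (Db _ _) _; rewrite mulrA ler_wpM2l ?mulr_ge0 ?sqn_ge0//.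
  exact: ltW.
apply/sqmod_eq0/le_anti; rewrite sqmod_ge0 andbT.
apply: (@le0_arbitrarily_small _ _ (4 * sqn b1)).
  by rewrite mulr_ge0 ?sqn_ge0.
move=> e /(gns_denseP a1)[x Mx xe].
have -> : D a1 b1 = D (a1 - gns_map L2G x) b1 by rewrite DBl Mb ?subr0.
apply: le_trans (Db _ _) _; rewrite -mulrA ler_pM2l// mulrC.
by rewrite ler_wpM2l ?sqn_ge0// ltW.
Qed.

Lemma sqn_gns_coord a : sqn (gns_coord a) = sqn a.
Proof. by rewrite /sqn gns_coord_dot. Qed.

Lemma gns_coord_sum (s : seq G) (f : G -> R[i]) : uniq s ->
  gns_coord (\sum_(g <- s) f g *: gns_basis g) = fin_l2 s f.
Proof.
move=> us; rewrite (lin_sum gns_coord_linear) fin_l2_delta//.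
apply: eq_bigr => g _; rewrite (linZ gns_coord_linear) gns_coord_map.
  by rewrite gns_basisE.
exact: group_vN_left_regular.
Qed.

(** The range contains the finitely supported vectors. As [gns_coord] is isometric, preimages of
    approximations of [f] form a Cauchy sequence, whose limit is mapped to [f]. *)
Lemma gns_coord_surj (f : l2 R G) : exists a, gns_coord a = f.
Proof.
have step (n : nat) : exists a, sqn (f - gns_coord a) < n.+1%:R^-1.
  have [|s us sf] := @fin_l2_approx R G f n.+1%:R^-1.
    by rewrite invr_gt0.
  by exists (\sum_(g <- s) f g *: gns_basis g); rewrite gns_coord_sum.
have [u uP] := choice step.
have uB m n : sqn (u m - u n) <= 2 * m.+1%:R^-1 + 2 * n.+1%:R^-1.
  rewrite -sqn_gns_coord (linB gns_coord_linear).
  apply: le_trans (sqnB_le _ f _) _; rewrite sqnBC.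
  by rewrite lerD// ler_pM2l// ltW.
have small (e : R) : 0 < e ->
    exists N, forall n, (N <= n)%N -> n.+1%:R^-1 < e.
  move=> e0; have [N _ Nn] := near_infty_natSinv_lt (PosNum e0).
  by exists N => n /Nn.
have [a ua] : exists a, u @ \oo --> a.
  apply: cauchy_sqn => e e0; have [|N NP] := small (e / 4).
    by rewrite divr_gt0.
  exists N => m n /NP m4 /NP n4; apply: le_lt_trans (uB m n) _.
  by move: m4 n4; move: (m.+1%:R^-1) (n.+1%:R^-1) => x y; lra.
exists a; apply/esym/subr0_eq/sqn_eq0/le_anti; rewrite sqn_ge0 andbT.
apply: (@le0_arbitrarily_small _ _ 4) => // e e0.
have [N1 N1P] := small e e0.
move/cvg_sqnP : ua => /(_ e e0)[N2 N2P].
pose n := maxn N1 N2.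
have n1 := N1P n (leq_maxl _ _); have n2 := N2P n (leq_maxr _ _).
apply: le_trans (sqnB_le f (gns_coord (u n)) _) _.
rewrite -(linB gns_coord_linear) sqn_gns_coord.
by move: n1 n2 (uP n); move: (n.+1%:R^-1) => x; lra.
Qed.

(** [J] exchanges the basis vectors of [g] and [g^-1] and reverses inner products. A real weight
    invariant under inversion therefore gives a multiplication operator commuting with [J]. *)
Lemma gns_star_coord (J : L2G -> L2G) : antiunitary_star_extension J ->
  forall a g, gns_coord (J a) g = (gns_coord a g^-1%g)^*.
Proof.
move=> [_ Jdot _ Jstar] a g; rewrite !gns_coordE.
have <- : J (gns_basis g^-1%g) = gns_basis g.
  apply: Jstar; try exact: group_vN_left_regular.
  by have := @left_regular_adjoint R G g^-1%g; rewrite invgK.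
by rewrite Jdot -hdotC.
Qed.

Lemma gns_coord_unit : gns_coord (gns_map L2G id) = delta 1%g.
Proof.
have idE : id = @left_regular R G 1%g.
  by apply/funext => u; apply: l2_ext => g; rewrite left_regularE invg1 mul1g.
by rewrite gns_coord_map// idE; exact: group_vN_left_regular.
Qed.

End gns_model.

(** * Diagonal operators *)

Section diagonal_operators.
Context {R : realType} {H : hilbertType R} {T : choiceType}.
Variable U : H -> l2 R T.
Hypothesis U_linear : linear U.
Hypothesis U_dot : forall a b, hdot (U a) (U b) = hdot a b.
Hypothesis U_surj : forall f, exists a, U a = f.
Implicit Types (a b : H) (f : l2 R T) (w : T -> R[i]) (r : T -> R).

Lemma sqn_U a : sqn (U a) = sqn a.
Proof. by rewrite /sqn U_dot. Qed.

Lemma U_inj a b : (forall i, U a i = U b i) -> a = b.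
Proof.
move=> /l2_ext ab; apply/subr0_eq/sqn_eq0.
by rewrite -sqn_U (linB U_linear) ab subrr sqn0.
Qed.

Definition Uinv f : H := sval (cid (U_surj f)).

Lemma UinvK f : U (Uinv f) = f.
Proof. by rewrite /Uinv; case: cid. Qed.

Lemma U_linE (z : R[i]) a b i : U (z *: a + b) i = z * U a i + U b i.
Proof. by rewrite U_linear. Qed.

Lemma U_subE a b i : U (a - b) i = U a i - U b i.
Proof. by rewrite (linB U_linear). Qed.

Lemma U_scaleE (z : R[i]) a i : U (z *: a) i = z * U a i.
Proof. by rewrite (linZ U_linear). Qed.

Lemma U_0E i : U 0 i = 0.
Proof. by rewrite (lin0 U_linear). Qed.

Lemma sqmod_U_le a i : sqmod (U a i) <= sqn a.
Proof.
by rewrite -sqn_U; have := @sum_sqmod_le _ _ (U a) [:: i] isT; rewrite big_seq1.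
Qed.

Definition diag_dom w : set H :=
  [set a | (fun i => w i * U a i) \in @l2_pred R T].

(* Takes the junk value 0 outside [diag_dom w]. *)
Definition diag_mul w a : H := Uinv (insubd 0 (fun i => w i * U a i)).

Lemma diag_mulE w a i : diag_dom w a -> U (diag_mul w a) i = w i * U a i.
Proof. by move=> wa; rewrite UinvK -[LHS]/((val _) i) insubdK. Qed.

Lemma diag_domI w a f : (forall i, f i = w i * U a i) -> diag_dom w a.
Proof.
move=> fE; rewrite /diag_dom /= (_ : (fun i => _) = f); first exact: l2P.
by apply/funext => i; rewrite fE.
Qed.

(** Exhibiting a vector with the expected coordinates settles membership in the domain and the value
    at once. *)
Lemma diag_mul_unique w a b : (forall i, U b i = w i * U a i) ->
  diag_dom w a /\ diag_mul w a = b.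
Proof.
move=> h; have wa := diag_domI h.
by split=> //; apply: U_inj => i; rewrite diag_mulE.
Qed.

Lemma diag_mul_lin w (z : R[i]) a b : diag_dom w a -> diag_dom w b ->
  diag_dom w (z *: a + b) /\
  diag_mul w (z *: a + b) = z *: diag_mul w a + diag_mul w b.
Proof.
move=> wa wb; apply: diag_mul_unique => i.
by rewrite !U_linE !diag_mulE//; ring.
Qed.

Lemma diag_mul_sub w a b : diag_dom w a -> diag_dom w b ->
  diag_dom w (a - b) /\ diag_mul w (a - b) = diag_mul w a - diag_mul w b.
Proof.
move=> wa wb; apply: diag_mul_unique => i.
by rewrite !U_subE !diag_mulE//; ring.
Qed.

Lemma diag_dom0 w : diag_dom w 0.
Proof. by apply: (@diag_domI _ _ 0) => i; rewrite U_0E mulr0. Qed.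

Lemma diag_dom_fin w s (f : T -> R[i]) : diag_dom w (Uinv (fin_l2 s f)).
Proof.
apply: (@diag_domI _ _ (fin_l2 s (fun i => w i * f i))) => i.
by rewrite UinvK /=; case: ifP; rewrite ?mulr0.
Qed.

Lemma diag_dom_dense w : closure (diag_dom w) = [set: H].
Proof.
rewrite -subTset => a _; apply/closure_sqnP => e e0.
have [s us se] := fin_l2_approx (U a) e0.
exists (Uinv (fin_l2 s (U a))); first exact: diag_dom_fin.
by rewrite -sqn_U (linB U_linear) UinvK.
Qed.

Lemma diag_dom_bounded w (C : R) a : 0 <= C -> (forall i, sqmod (w i) <= C) ->
  diag_dom w a /\ sqn (diag_mul w a) <= C * sqn a.
Proof.
move=> C0 wC; pose f i := w i * U a i.
have [||sf fC] := @rsum_le_fset _ _ (fun i => sqmod (f i)) (C * sqn a).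
- by move=> i; exact: sqmod_ge0.
- move=> s us; rewrite -sqn_U.
  apply: le_trans (ler_wpM2l C0 (sum_sqmod_le (U a) us)).
  rewrite mulr_sumr; apply: ler_sum => i _; rewrite sqmodM.
  by rewrite ler_wpM2r ?sqmod_ge0.
have fm : f \in l2_pred by exact/asboolP.
have wa : diag_dom w a by exact: fm.
split=> //; rewrite -sqn_U (_ : U _ = L2 fm) ?sqn_l2//.
by apply: l2_ext => i; rewrite diag_mulE.
Qed.

Definition diag_op r : @operator R H :=
  Operator (diag_dom (fun i => (r i)%:C)) (diag_mul (fun i => (r i)%:C)).

Lemma hdot_diag r a b : diag_dom (fun i => (r i)%:C) b ->
  hdot a (diag_mul (fun i => (r i)%:C) b) =
  csum (fun i => (r i)%:C * ((U a i)^* * U b i)).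
Proof.
move=> rb; rewrite -U_dot hdot_l2E; congr csum; apply/funext => i.
by rewrite diag_mulE//; ring.
Qed.

Lemma diag_self_adjoint r : self_adjoint (diag_op r).
Proof.
have lo : linear_operator (diag_op r).
  by split=> [|z a b ra rb]; [exact: diag_dom0|exact: diag_mul_lin].
split=> //; first exact: diag_dom_dense.
apply/seteqP; split=> [[p q] /= adj|[p q] /= [pd ->] a ra]; last first.
  rewrite hdot_diag// -U_dot hdot_l2E; congr csum; apply/funext => i.
  by rewrite diag_mulE// [X in X * _]conj_realM; ring.
suff h i : U q i = (r i)%:C * U p i by have [? ->] := diag_mul_unique h.
(* The basis vector at [i] is an eigenvector for [r i]; pairing with it reads off the coordinate [i]
   of [p] and of [q]. *)
pose d := Uinv (fin_l2 [:: i] (fun=> 1)).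
have dd : diag_dom (fun i => (r i)%:C) d by exact: diag_dom_fin.
have dE x : hdot d x = U x i.
  rewrite -U_dot UinvK hdot_fin_l2// big_seq1.
  by rewrite [X in X * _]conj1 mul1r.
have := adj d dd; rewrite /= dE => <-.
have -> : diag_mul (fun i => (r i)%:C) d = (r i)%:C *: d.
  apply: U_inj => j; rewrite diag_mulE// U_scaleE UinvK /= inE.
  by case: eqP => [->//|_]; rewrite !mulr0.
by rewrite hdotZl dE [X in X * _]conj_real.
Qed.

Lemma diag_nonneg r : (forall i, 0 <= r i) -> nonneg_operator (diag_op r).
Proof.
move=> r0 a ra; rewrite /= hdot_diag// /csum lecE /=.
have h i : (r i)%:C * ((U a i)^* * U a i) = (r i * sqmod (U a i))%:C.
  by case: (U a i) => x y; apply/eqP; rewrite eq_complex /sqmod /=;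
    apply/andP; split; apply/eqP; ring.
under [X in rsum X]eq_fun do rewrite h.
under [X in _ && (_ <= rsum X)]eq_fun do rewrite h.
rewrite (_ : rsum _ = 0) ?eqxx ?rsum_ge0// => [i|].
  by rewrite /= mulr_ge0 ?sqmod_ge0.
by rewrite rsum_pos// esum1.
Qed.

Section square_root.
Variable r : T -> R.
Hypothesis r_ge0 : forall i, 0 <= r i.
Let q i := (Num.sqrt (r i))%:C.

Lemma sqmod_sqrtM i (z : R[i]) : sqmod (q i * z) = r i * sqmod z.
Proof. by rewrite sqmodM /q /sqmod /= expr0n addr0 sqr_sqrtr. Qed.

Lemma sqrt_mulE i (z : R[i]) : q i * (q i * z) = (r i)%:C * z.
Proof. by rewrite mulrA -rmorphM/= -expr2 sqr_sqrtr. Qed.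

(** Since [r <= 1 + r^2], the energy density is dominated by those of [a] and of its image under
    multiplication by [r]. *)
Lemma diag_sqrt_dom a : diag_dom (fun i => (r i)%:C) a -> diag_dom q a.
Proof.
move=> /asboolP ra; apply/asboolP.
have := rsummableD (l2_sq (U a)) ra; apply: le_rsummable => i.
rewrite (ger0_norm (sqmod_ge0 _)) ger0_norm; last first.
  by apply: addr_ge0; exact: sqmod_ge0.
rewrite [leLHS](sqmod_sqrtM i (U a i)) [X in _ + X]sqmodM.
have -> : sqmod (r i)%:C = r i ^+ 2 by rewrite /sqmod /= expr0n addr0.
have := sqmod_ge0 (U a i); have := sqr_ge0 (r i - 1); have := r_ge0 i.
by set x := sqmod _; nra.
Qed.

Lemma diag_is_sqrt :
  is_sqrt_operator (diag_op (fun i => Num.sqrt (r i))) (diag_op r).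
Proof.
split; first exact: diag_self_adjoint.
- by apply: diag_nonneg => i; exact: sqrtr_ge0.
- apply/seteqP; split=> a /=.
    move=> ra; have qa := diag_sqrt_dom ra; split=> //.
    apply: (@diag_domI _ _ (U (diag_mul (fun i => (r i)%:C) a))) => i.
    by rewrite !diag_mulE// -sqrt_mulE.
  move=> [qa qqa]; apply: (@diag_domI _ _ (U (diag_mul q (diag_mul q a)))) => i.
  by rewrite !diag_mulE// -sqrt_mulE.
- move=> a /= ra; have qa := diag_sqrt_dom ra.
  have [] // := @diag_mul_unique (fun i => (r i)%:C) a (diag_mul q (diag_mul q a)).
  move=> i; rewrite !diag_mulE ?sqrt_mulE//.
  apply: (@diag_domI _ _ (U (diag_mul (fun i => (r i)%:C) a))) => j.
  by rewrite !diag_mulE// -sqrt_mulE.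
Qed.

Lemma sqn_diag_sqrt a : diag_dom q a ->
  sqn (diag_mul q a) = rsum (fun i => r i * sqmod (U a i)).
Proof.
move=> qa; rewrite -sqn_U sqn_l2 /l2_sqnorm; congr rsum; apply/funext => i.
by rewrite diag_mulE// sqmod_sqrtM.
Qed.

Lemma diag_sqrt_summable a : diag_dom q a ->
  rsummable (fun i => r i * sqmod (U a i)).
Proof.
move=> /asboolP; congr rsummable; apply/funext => i.
by rewrite sqmod_sqrtM.
Qed.

(** A uniform bound on finite sums yields both finiteness of the energy and its bound; the Markov
    property is reached this way. *)
Lemma diag_sqrt_bound a (M : R) :
  (forall s, uniq s -> \sum_(i <- s) r i * sqmod (U a i) <= M) ->
  diag_dom q a /\ sqn (diag_mul q a) <= M.
Proof.
move=> sM; have [|//|sa aM] := @rsum_le_fset _ _ (fun i => r i * sqmod (U a i)) M.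
  by move=> i; rewrite mulr_ge0 ?sqmod_ge0.
have qa : diag_dom q a.
  apply/asboolP; move: sa; congr rsummable; apply/funext => i.
  by rewrite sqmod_sqrtM.
by rewrite sqn_diag_sqrt.
Qed.

(** The images of [u n] converge by completeness to some [b]. Coordinates are continuous, so [b] has
    the coordinates expected of the image of [a]. *)
Lemma diag_sqrt_closed (u : nat -> H) a : (forall n, diag_dom q (u n)) ->
  u @ \oo --> a ->
  (forall e : R, 0 < e -> exists N, forall m n, (N <= m)%N -> (N <= n)%N ->
     sqn (diag_mul q (u m - u n)) < e) ->
  diag_dom q a /\ forall e : R, 0 < e ->
    exists N, forall n, (N <= n)%N -> sqn (diag_mul q (u n - a)) < e.
Proof.
move=> qu ua uC; have [|b ub] := @cauchy_sqn _ _ (fun n => diag_mul q (u n)).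
  move=> e /uC[N NP]; exists N => m n mN nN.
  by have [_ <-] := diag_mul_sub (qu m) (qu n); exact: NP.
have bE i : U b i = q i * U a i.
  apply/subr0_eq/sqmod_eq0/le_anti; rewrite sqmod_ge0 andbT.
  (* The coordinate error splits into that of [diag_mul q (u n) - b] and [q i] times that of
     [u n - a], where [|q i|^2 = r i]. *)
  apply: (@le0_arbitrarily_small _ _ (2 + 2 * r i)).
    by rewrite addr_ge0 ?mulr_ge0.
  move=> e e0; move/cvg_sqnP : (ub) => /(_ e e0)[N1 N1P].
  move/cvg_sqnP : (ua) => /(_ e e0)[N2 N2P]; pose n := maxn N1 N2.
  have n1 := N1P n (leq_maxl _ _); have n2 := N2P n (leq_maxr _ _).
  have -> : U b i - q i * U a i =
      q i * U (u n - a) i - U (diag_mul q (u n) - b) i.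
    by rewrite !U_subE diag_mulE//; ring.
  apply: le_trans (sqmodB_le _ _) _; rewrite sqmod_sqrtM.
  have := sqmod_U_le (u n - a) i; have := sqmod_U_le (diag_mul q (u n) - b) i.
  have := r_ge0 i; move: n1 n2.
  by set x := sqn _; set y := sqn _; set z := sqmod _; set t := sqmod _; nra.
have [qa aE] := diag_mul_unique bE; split=> // e e0.
move/cvg_sqnP : ub => /(_ e e0)[N NP]; exists N => n /NP.
by have [_ ->] := diag_mul_sub (qu n) qa; rewrite aE.
Qed.

End square_root.
End diagonal_operators.

Lemma sqmod_real_sub_ge1 (R : realType) (x : R) (z : R[i]) :
  Re z + 1 < x -> 1 <= sqmod (x%:C - z).
Proof.
case: z => a b; rewrite /sqmod /= => ax.
by have := sqr_ge0 (0 - b); nra.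
Qed.

(** * Spectrum of diagonal operators with finite sublevel sets *)

Section diagonal_spectrum.
Context {R : realType} {H : hilbertType R} {T : choiceType}.
Variable U : H -> l2 R T.
Hypothesis U_linear : linear U.
Hypothesis U_dot : forall a b, hdot (U a) (U b) = hdot a b.
Hypothesis U_surj : forall f, exists a, U a = f.
Variable r : T -> R.
Hypothesis r_proper : forall x : R,
  exists s : seq T, forall i, r i <= x -> i \in s.
Local Notation L := (diag_op U_surj r).
Local Notation rc := (fun i => (r i)%:C).

(** Values above [Re z + 1] are at distance at least 1 from [z], and the other indices lie in a
    finite list, so a minimum of finitely many positive squared distances suffices. *)
Lemma diag_gap (z : R[i]) : exists2 e : R, 0 < e &
  forall i, sqmod ((r i)%:C - z) < e -> (r i)%:C = z.
Proof.
have [s sP] := r_proper (Re z + 1).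
have [e e0 se] : exists2 e : R, 0 < e &
    forall i, i \in s -> sqmod ((r i)%:C - z) < e -> (r i)%:C = z.
  elim: s {sP} => [|j s [e e0 ih]]; first by exists 1.
  have [jz|jz] := eqVneq (r j)%:C z.
    by exists e => // i; rewrite inE => /predU1P[->//|]; exact: ih.
  have j0 : 0 < sqmod ((r j)%:C - z).
    rewrite lt_def sqmod_ge0 andbT; apply: contra jz => /eqP/sqmod_eq0/subr0_eq.
    by move=> ->.
  exists (Num.min e (sqmod ((r j)%:C - z))) => [|i]; first by rewrite lt_min e0.
  rewrite inE lt_min => /predU1P[->|/ih h] /andP[]; first by rewrite ltxx.
  by move=> /h.
exists (Num.min e 1) => [|i]; first by rewrite lt_min e0 ltr01.
rewrite lt_min => /andP[ie i1].
have [/se/(_ ie)//|] := boolP (i \in s); move/negP => is0.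
have /le_lt_trans/(_ i1) : 1 <= sqmod ((r i)%:C - z); last by rewrite ltxx.
by apply: sqmod_real_sub_ge1; rewrite ltNge; apply/negP => /sP.
Qed.

Lemma diag_eigenspace (z : R[i]) a i : Defs.eigenspace L z a -> U a i != 0 ->
  (r i)%:C = z.
Proof.
move=> [/= ra La] ai.
have := congr1 (fun b => U b i) La; rewrite /= diag_mulE// U_scaleE//.
by move/(mulIf ai).
Qed.

Lemma diag_eigenvector i : exists2 a, a != 0 & Defs.eigenspace L (r i)%:C a.
Proof.
pose a := Uinv U_surj (fin_l2 [:: i] (fun=> 1)).
have aE j : U a j = if j == i then 1 else 0.
  by rewrite UinvK /= inE.
exists a.
  apply/eqP => a0; have := aE i; rewrite a0 U_0E// eqxx => /esym/eqP.
  by rewrite oner_eq0.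
have [|ra La] := @diag_mul_unique _ _ _ _ U_linear U_dot U_surj rc a ((r i)%:C *: a).
  by move=> j; rewrite U_scaleE// aE; case: eqP => [->//|_]; rewrite !mulr0.
exact: conj ra La.
Qed.

(** If [z] is not a value of [r], the gap bounds [(r - z)^-1], and multiplication by this function
    inverts [L - z]. *)
Lemma diag_spectrum (z : R[i]) : spectrum L z -> exists i, z = (r i)%:C.
Proof.
move=> zL; apply: contrapT => nz; apply: zL.
have [e e0 he] := diag_gap z.
have {}he i : e <= sqmod ((r i)%:C - z).
  by rewrite leNgt; apply/negP => /he iz; apply: nz; exists i.
have rz0 i : (r i)%:C - z != 0.
  apply/eqP => h; have := he i; rewrite h /sqmod /= expr0n addr0 leNgt.
  by rewrite e0.
pose t i := ((r i)%:C - z)^-1.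
have tC i : sqmod (t i) <= e^-1.
  rewrite -(ler_pM2l e0) divff ?gt_eqF//.
  have <- : sqmod ((r i)%:C - z) * sqmod (t i) = 1.
    by rewrite -sqmodM divff// /sqmod /= expr0n addr0 expr1n.
  by rewrite ler_wpM2r ?sqmod_ge0.
have e1 : 0 <= e^-1 by rewrite invr_ge0 ltW.
have bt b := @diag_dom_bounded _ _ _ _ U_dot U_surj t _ b e1 tC.
have uniq_sol a b : op_dom L a /\ L a - z *: a = b <-> a = diag_mul U_surj t b.
  have [tb _] := bt b.
  split=> [[/= ra Lab]|->].
    apply: (U_inj U_linear U_dot) => i.
    rewrite diag_mulE// -Lab U_subE// U_scaleE// diag_mulE//.
    by rewrite -mulrBl mulKf.
  have [|ra La] := @diag_mul_unique _ _ _ _ U_linear U_dot U_surj rc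
      (diag_mul U_surj t b) (b + z *: diag_mul U_surj t b).
    move=> i; rewrite addrC U_linE// diag_mulE//.
    have e2 : ((r i)%:C - z) * (t i * U b i) = U b i by exact: mulVKf.
    by rewrite -[X in _ + X]e2; ring.
  by split=> //=; rewrite La addrK.
split=> [b|].
  exists (diag_mul U_surj t b); split; first exact/uniq_sol.
  by move=> a /uniq_sol ->.
exists (Num.sqrt e^-1)%:C => a ra.
have /uniq_sol aE : op_dom L a /\ L a - z *: a = L a - z *: a by [].
have [_] := bt (L a - z *: a); rewrite -aE => h.
by rewrite !normhE -rmorphM/= lecR -sqrtrM// ler_wsqrtr.
Qed.

(** An eigenvector has all its nonzero coordinates in [s]. More than [size s] eigenvectors would
    have a coordinate matrix with more rows than columns, and a nonzero row in its left kernel is a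
    linear relation between them. *)
Lemma diag_dimension (z : R[i]) (s : seq T) :
  (forall i, (r i)%:C = z -> i \in s) ->
  (dimension (Defs.eigenspace L z) <= (size s)%:R%:E)%E.
Proof.
move=> sP; apply: ge_ereal_sup => _ [n [v vind vz] <-].
rewrite lee_fin ler_nat leqNgt; apply/negP => sn.
pose A : 'M[R[i]]_(n, size s) := \matrix_(i, j) U (v i) (tnth (in_tuple s) j).
have /rowV0Pn[c /sub_kermxP cA c0] : kermx A != 0.
  by rewrite kermx_eq0 /row_free; apply: contraTneq sn => <-;
    rewrite -leqNgt rank_leq_col.
move/negP: c0; apply; apply/eqP/rowP => i; rewrite mxE.
apply: (vind (fun i => c 0 i)); apply: (U_inj U_linear U_dot) => j.
rewrite U_0E// (lin_sum U_linear).
have sumE (I : finType) (F : I -> l2 R T) : (\sum_k F k) j = \sum_k F k j.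
  by elim/big_rec2: _ => // k x y _ <-; rewrite l2_addE.
rewrite sumE; under eq_bigr do rewrite (linZ U_linear) l2_scaleE.
have [js|js] := boolP (j \in s); last first.
  rewrite big1// => k _; apply/eqP; rewrite mulf_eq0 orbC.
  apply/orP; left; apply/negPn/negP => /(diag_eigenspace (vz k))/sP.
  exact/negP.
have jt : (index j s < size s)%N by rewrite index_mem.
have := congr1 (fun B : 'rV_(size s) => B 0 (Ordinal jt)) cA; rewrite !mxE => cAj.
rewrite -[RHS]cAj.
by apply: eq_bigr => k _; rewrite mxE (tnth_nth j)/= nth_index.
Qed.

Lemma diag_discrete_spectrum : discrete_spectrum L.
Proof.
move=> _ /diag_spectrum[i ->]; split.
- have [e e0 he] := diag_gap (r i)%:C; exists (Num.sqrt e).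
    by rewrite sqrtr_gt0.
  move=> _ /diag_spectrum[j ->]; rewrite norm_sqmod ltcR ltr_sqrt//.
  exact: he.
- exact: diag_eigenvector.
- have [s sP] := r_proper (r i).
  apply: le_lt_trans (@diag_dimension _ s _) (ltry _).
  by move=> j [/esym ri]; apply: sP; rewrite ri.
Qed.

(** Double counting: the dimension for [z] is at most the number of indices of [s] with value [z],
    and each index has a single value. *)
Lemma diag_eigenvalue_count (x : R) (s : seq T) : uniq s ->
  (forall i, r i <= x -> i \in s) ->
  (eigenvalue_count L x <= (size s)%:R%:E)%E.
Proof.
move=> us sP; apply: ge_ereal_sup => _ [X [finX Xx] <-].
have dimX z : X z ->
    (dimension (Defs.eigenspace L z) <=
       (count (fun i => (r i)%:C == z) s)%:R%:E)%E.
  move=> /Xx[_ zx]; rewrite -size_filter; apply: diag_dimension => i iz.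
  by rewrite mem_filter iz eqxx sP// -lecR iz.
rewrite fsbig_finite//=.
apply: (@le_trans _ _ (\sum_(z <- fset_set X)
    (count (fun i => (r i)%:C == z) s)%:R%:E)%E).
  rewrite big_seq [leRHS]big_seq; apply: lee_sum => z.
  by rewrite in_fset_set// inE; exact: dimX.
rewrite sumEFin lee_fin -natr_sum ler_nat.
under eq_bigr do rewrite -sum1_count big_mkcond.
rewrite exchange_big/= -sum1_size; apply: leq_sum => i _.
rewrite -big_mkcond sum1_count (@eq_count _ _ (pred1 (r i)%:C)).
  by rewrite count_uniq_mem ?fset_uniq ?leq_b1.
by move=> z /=; rewrite eq_sym.
Qed.

End diagonal_spectrum.

(** * Schur multipliers and the positive cone *)

Section Schur_multipliers.
Context {R : realType} {G : groupType}.
Implicit Types (u v : l2 R G) (x y : l2 R G -> l2 R G) (phi : G -> R).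

Lemma l2_sumE (I : Type) (s : seq I) (F : I -> l2 R G) (k : G) :
  (\sum_(i <- s) F i) k = \sum_(i <- s) F i k.
Proof. by elim/big_rec2: _ => // i a b _ <-; rewrite l2_addE. Qed.

Lemma hdot_fin_op y (t : seq G) (f : G -> R[i]) : linear y -> uniq t ->
  hdot (fin_l2 t f) (y (fin_l2 t f)) =
  \sum_(k <- t) \sum_(l <- t) (f k)^* * (f l * y (delta l) k).
Proof.
move=> ly ut; rewrite hdot_fin_l2//; apply: eq_bigr => k _.
rewrite fin_l2_delta// (lin_sum ly) l2_sumE mulr_sumr.
by apply: eq_bigr => l _; rewrite (linZ ly) l2_scaleE.
Qed.

Lemma positive_op_fin y : bounded_op y ->
  (forall (t : seq G) u, uniq t ->
     0 <= hdot (fin_l2 t u) (y (fin_l2 t u))) ->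
  positive_op y.
Proof.
move=> /bounded_opP[ly [C C0 yC]] fin u; apply: ge0_complex_closed => e e0.
(* Replacing [u] by its truncation changes [<u, y u>] by two terms, each of squared modulus at most
   [C * |u|^2 * |d|^2]; the factor 4 comes from [sqmodB_le], and the 1 keeps the divisor
   positive. *)
have k0 : 0 < 4 * (C * sqn u) + 1 by rewrite ltr_wpDl// !mulr_ge0 ?sqn_ge0.
have [t ut te] := fin_l2_approx u (divr_gt0 e0 k0).
exists (hdot (fin_l2 t u) (y (fin_l2 t u))); first exact: fin.
set w := fin_l2 t u in te *; set d := u - w in te *.
have wu : sqn w <= sqn u by rewrite sqn_fin_l2// sum_sqmod_le.
have -> : hdot u (y u) - hdot w (y w) = hdot d (y u) - hdot (- w) (y d).
  by rewrite /d (linB ly) hdotNl !hdotBr !hdotBl; ring.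
apply: le_lt_trans (sqmodB_le _ _) _.
have h1 : sqmod (hdot d (y u)) <= (C * sqn u) * sqn d.
  apply: le_trans (hdot_CauchySchwarz _ _) _; rewrite mulrC.
  by rewrite ler_wpM2r ?sqn_ge0.
have h2 : sqmod (hdot (- w) (y d)) <= (C * sqn u) * sqn d.
  apply: le_trans (hdot_CauchySchwarz _ _) _; rewrite sqnN mulrAC mulrC.
  by rewrite ler_pM ?sqn_ge0.
move: te; rewrite ltr_pdivlMr// => te.
by have := sqn_ge0 d; move: h1 h2 te; move: (C * sqn u) => M; lra.
Qed.

(* Positive semi-definiteness of the kernel [phi (k * l^-1)], expressed by a
   Gram decomposition on each finite set. *)
Definition positive_definite phi : Prop := forall t : seq G,
  exists (A : seq G) (chi : G -> G -> R), forall k l, k \in t -> l \in t ->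
    phi (k * l^-1)%g = \sum_(j <- A) chi j k * chi j l.

Lemma convolution_delta1 (s : seq G) (f : G -> R[i]) : uniq s ->
  convolution s f (delta 1%g) = fin_l2 s f.
Proof.
move=> us; rewrite fin_l2_delta//; apply: eq_bigr => g _.
by rewrite left_regular_delta mulg1.
Qed.

(* The Gram decomposition of [phi] turns [<u, y u>] into a sum of terms
   [<D u, x (D u)>] with [D] diagonal. *)
Lemma Schur_positive phi (s : seq G) x : positive_definite phi -> uniq s ->
  (forall g, g \notin s -> phi g = 0) -> group_vN R G x -> positive_op x ->
  positive_op (convolution s (fun g => (phi g)%:C * x (delta 1%g) g)).
Proof.
move=> pd us phis Mx x0; set y := convolution s _.
have My : group_vN R G y by exact: group_vN_convolution.
(* The matrix of [y] is the entrywise product of the kernel of [phi] with the matrix of [x]. *)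
have yE k l : y (delta l) k = (phi (k * l^-1)%g)%:C * x (delta l) k.
  rewrite (group_vN_delta _ _ My) (group_vN_delta _ _ Mx) /y.
  by rewrite convolution_delta1//=; case: ifPn => // /phis ->; rewrite mul0r.
apply: positive_op_fin; first exact: My.1.
move=> t u ut; have ly : linear y := My.1.1; have lx : linear x := Mx.1.1.
rewrite hdot_fin_op//; have [A [chi chiP]] := pd t.
suff -> : \sum_(k <- t) \sum_(l <- t) (u k)^* * (u l * y (delta l) k) =
    \sum_(j <- A) hdot (fin_l2 t (fun k => (chi j k)%:C * u k))
                     (x (fin_l2 t (fun k => (chi j k)%:C * u k))).
  by apply: sumr_ge0 => j _; exact: x0.
under [RHS]eq_bigr do rewrite hdot_fin_op//.
rewrite [RHS]exchange_big/=; rewrite !big_seq; apply: eq_bigr => k kt.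
rewrite exchange_big/= !big_seq; apply: eq_bigr => l lt.
rewrite yE chiP// rmorph_sum/= mulr_suml !mulr_sumr; apply: eq_bigr => j _.
by rewrite rmorphM/= [X in _ = X * _]conj_realM; ring.
Qed.

End Schur_multipliers.

Section cone.
Context {R : realType} {G : groupType}.
Variable L2G : gns (group_vN R G) (canonical_trace R G).
Local Notation U := (@gns_coord R G L2G).
Local Notation U_linear := (@gns_coord_linear R G L2G).
Local Notation U_dot := (@gns_coord_dot R G L2G).
Local Notation U_surj := (@gns_coord_surj R G L2G).
Implicit Types (a b c : L2G).

Lemma L2_cone_conv a b (s t : R) : 0 <= s -> 0 <= t ->
  L2_cone a -> L2_cone b -> L2_cone (s%:C *: a + t%:C *: b).
Proof.
move=> s0 t0 /closure_sqnP ha /closure_sqnP hb; apply/closure_sqnP => e e0.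
have k0 : 0 < 2 * s ^+ 2 + 2 * t ^+ 2 + 1.
  by have := sqr_ge0 s; have := sqr_ge0 t; lra.
have [_ [x [Mx x0] <-] xa] := ha _ (divr_gt0 e0 k0).
have [_ [y [My y0] <-] yb] := hb _ (divr_gt0 e0 k0).
(* [gns_linear] only applies to sums of the form [z *: y + y']. *)
have tyE u : t%:C *: y u = (t%:C - 1) *: y u + y u.
  by rewrite scalerBl scale1r subrK.
pose ty u := (t%:C - 1) *: y u + y u.
have Mty : group_vN R G ty by exact: group_vN_linear.
exists (s%:C *: gns_map L2G x + t%:C *: gns_map L2G y).
  exists (fun u => s%:C *: x u + ty u).
    split; first exact: group_vN_linear.
    move=> u; rewrite /ty -tyE hdotDr !hdotZr.
    by apply: addr_ge0; apply: mulr_ge0; rewrite ?ler0c.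
  by rewrite gns_linear// [gns_map L2G ty]gns_linear// scalerBl scale1r subrK.
rewrite opprD addrACA -!scalerBr.
apply: le_lt_trans (sqnD_le _ _) _; rewrite !sqnZ.
have sq (r : R) : sqmod r%:C = r ^+ 2 by rewrite /sqmod /= expr0n addr0.
rewrite !sq; move: xa yb; set d := e / _ => xa yb.
have eE : e = (2 * s ^+ 2 + 2 * t ^+ 2 + 1) * d.
  by rewrite mulrC divfK// gt_eqF.
have d0 : 0 < d by exact: divr_gt0.
have := ler_wpM2l (sqr_ge0 s) (ltW xa); have := ler_wpM2l (sqr_ge0 t) (ltW yb).
by rewrite eE; lra.
Qed.

End cone.

(** * Markov property of multipliers *)

Section Markov.
Context {R : realType} {G : groupType}.
Variable L2G : gns (group_vN R G) (canonical_trace R G).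
Variable J : L2G -> L2G.
Hypothesis J_star : antiunitary_star_extension J.
Local Notation U := (@gns_coord R G L2G).
Local Notation U_linear := (@gns_coord_linear R G L2G).
Local Notation U_dot := (@gns_coord_dot R G L2G).
Local Notation U_surj := (@gns_coord_surj R G L2G).
Implicit Types (a b c : L2G).

Lemma star_sub a b : J (a - b) = J a - J b.
Proof.
have [Jlin _ _ _] := J_star; rewrite addrC -scaleN1r Jlin rmorphN1 scaleN1r.
by rewrite addrC.
Qed.

Lemma star_real_lin (s : R) a b : J (s%:C *: a + b) = s%:C *: J a + J b.
Proof. by have [Jlin _ _ _] := J_star; rewrite Jlin [X in X *: _]conj_real. Qed.

Lemma below_one_conv a b (t : R) : 0 <= t <= 1 -> below_one J a ->
  below_one J b -> below_one J (b + t%:C *: (a - b)).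
Proof.
move=> /andP[t0 t1] [Ja Pa] [Jb Pb]; split.
  by rewrite addrC star_real_lin star_sub -Ja -Jb.
have -> : gns_map L2G id - (b + t%:C *: (a - b)) =
    t%:C *: (gns_map L2G id - a) + (1 - t)%:C *: (gns_map L2G id - b).
  rewrite rmorphB/= rmorph1 scalerBl scale1r !scalerBr.
  apply: (U_inj U_linear U_dot) => g.
  rewrite !(linB U_linear, linD U_linear, linZ U_linear).
  by rewrite !(l2_subE, l2_addE, l2_scaleE); ring.
by apply: L2_cone_conv => //; rewrite subr_ge0.
Qed.

(** By convexity [b + t (c - b)] is a competitor of [b]. Comparing distances to [a] gives
    [2 Re <a - b, c - b> <= t |c - b|^2], with [t] arbitrarily small. *)
Lemma projection_variational a b c : is_projection (below_one J) a b ->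
  below_one J c -> Re (hdot (a - b) (c - b)) <= 0.
Proof.
move=> [Cb ab] Cc; set S := sqn (c - b).
apply: (@le0_arbitrarily_small _ _ S); first exact: sqn_ge0.
move=> e e0; have [t [t0 t1 te]] : exists t : R, [/\ 0 < t, t <= 1 & t <= e].
  by exists (Num.min e 1); rewrite lt_min e0 ltr01 !ge_min !lexx orbT.
have Ct : below_one J (b + t%:C *: (c - b)).
  by apply: below_one_conv => //; rewrite t1 ltW.
have := ab _ Ct; rewrite !normhE lecR.
rewrite ler_sqrt ?sqn_ge0// opprD addrA [leRHS]sqnB sqnZ hdotZr.
rewrite /(sqmod t%:C) /= expr0n addr0.
have -> : Re (t%:C * hdot (a - b) (c - b)) = t * Re (hdot (a - b) (c - b)).
  by case: (hdot _ _) => x y /=; ring.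
move: (Re _) => x h.
have {h} : t * (2 * x) <= t * (t * sqn (c - b)) by move: h; lra.
rewrite ler_pM2l// -/S => h; have S0 : 0 <= S by exact: sqn_ge0.
have := ler_wpM2r S0 te; have := mulr_ge0 S0 (ltW e0); lra.
Qed.

(** Invariance under inversion gives commutation with [J], the value at 1 fixes the unit, and the
    bounds 0 and 1 make the multiplier a contraction with nonnegative form. *)
Record markov_multiplier (phi : G -> R) : Prop := {
  multiplier_pd : positive_definite phi ;
  multiplier_support : exists2 s : seq G, uniq s &
    forall g, g \notin s -> phi g = 0 ;
  multiplier_ge0 : forall g, 0 <= phi g ;
  multiplier_le1 : forall g, phi g <= 1 ;
  multiplier_inv : forall g, phi g^-1%g = phi g ;
  multiplier_unit : phi 1%g = 1 }.

Section multiplier.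
Variable phi : G -> R.
Hypothesis phi_markov : markov_multiplier phi.
Let T := diag_mul U_surj (fun g => (phi g)%:C).

Lemma sqmod_multiplier_le1 g : sqmod (phi g)%:C <= 1.
Proof.
rewrite /sqmod /= expr0n addr0 expr_le1 ?multiplier_ge0//.
exact: multiplier_le1.
Qed.

Lemma multiplier_dom a : diag_dom U (fun g => (phi g)%:C) a.
Proof.
by have [] := diag_dom_bounded U_dot U_surj a ler01 sqmod_multiplier_le1.
Qed.

Lemma multiplierE a g : U (T a) g = (phi g)%:C * U a g.
Proof. by rewrite diag_mulE//; exact: multiplier_dom. Qed.

Lemma sqn_multiplier_le a : sqn (T a) <= sqn a.
Proof.
have [_] := diag_dom_bounded U_dot U_surj a ler01 sqmod_multiplier_le1.
by rewrite mul1r.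
Qed.

Lemma multiplier_sub a b : T (a - b) = T a - T b.
Proof.
by have [] := diag_mul_sub U_linear U_dot U_surj
  (multiplier_dom a) (multiplier_dom b).
Qed.

Lemma multiplier_symmetric a b : hdot (T a) b = hdot a (T b).
Proof.
have [_ _ adj] := diag_self_adjoint U_linear U_dot U_surj phi.
have : adjoint_graph (diag_op U_surj phi) (b, T b).
  by rewrite adj; split=> //=; exact: multiplier_dom.
by move=> /(_ a (multiplier_dom a)).
Qed.

(* Since [phi] has finite support, [T (gns_map x)] is the image of an element of
   the group algebra: the Schur multiplier is not needed on all of [group_vN]. *)
Lemma multiplier_cone a : L2_cone a -> L2_cone (T a).
Proof.
move=> /closure_sqnP ca; apply/closure_sqnP => e e0.
have [_ [x [Mx x0] <-] xa] := ca _ e0.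
exists (T (gns_map L2G x)); last first.
  by rewrite -multiplier_sub; apply: le_lt_trans (sqn_multiplier_le _) xa.
have [s us phis] := multiplier_support phi_markov.
exists (convolution s (fun g => (phi g)%:C * x (delta 1%g) g)).
  split; first exact: group_vN_convolution.
  exact: Schur_positive (multiplier_pd phi_markov) us phis Mx x0.
apply: (U_inj U_linear U_dot) => g.
rewrite multiplierE !gns_coord_map//; last exact: group_vN_convolution.
rewrite convolution_delta1//=; case: ifPn => // /phis ->.
by rewrite mul0r.
Qed.

Lemma multiplier_below_one b : below_one J b -> below_one J (T b).
Proof.
move=> [Jb Pb]; split.
  apply: (U_inj U_linear U_dot) => g.
  rewrite multiplierE {1}Jb !(gns_star_coord J_star) multiplierE.
  by rewrite [RHS]conj_realM multiplier_inv.
have -> : gns_map L2G id - T b = T (gns_map L2G id - b).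
  rewrite multiplier_sub; congr (_ - _); apply: (U_inj U_linear U_dot) => g.
  rewrite multiplierE gns_coord_unit deltaE.
  by case: eqP => [->|_]; rewrite ?multiplier_unit ?mulr1 ?mulr0.
exact: multiplier_cone.
Qed.

Definition multiplier_form a : R :=
  rsum (fun g => (1 - phi g) * sqmod (U a g)).

Lemma multiplier_formE a : multiplier_form a = Re (hdot a (a - T a)).
Proof.
rewrite -U_dot.
rewrite -[RHS]/(rsum (fun g => Re ((U a g)^* * U (a - T a) g))).
congr rsum; apply/funext => g; rewrite (linB U_linear) l2_subE multiplierE.
by case: (U a g) => x y; rewrite /sqmod /=; ring.
Qed.

Lemma multiplier_form_ge0 a : 0 <= multiplier_form a.
Proof.
apply: rsum_ge0 => g; rewrite mulr_ge0 ?sqmod_ge0// subr_ge0.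
exact: multiplier_le1.
Qed.

(* With [r := a - b], the form at [a] is the form at [b] plus the form at [r]
   plus [2 Re <r, b - T b>], and [Re <r, T b - b> <= 0] by projection. *)
Lemma multiplier_form_markov a b : is_projection (below_one J) a b ->
  multiplier_form b <= multiplier_form a.
Proof.
move=> ab; set r := a - b.
have aE : a = b + r by rewrite /r addrC subrK.
have h : Re (hdot r (T b - b)) <= 0.
  exact: (projection_variational ab (multiplier_below_one ab.1)).
have := multiplier_form_ge0 r; rewrite !multiplier_formE.
have -> : T a = T b + T r by rewrite /r multiplier_sub addrC subrK.
rewrite {1 2}aE; move: h; clearbody r.
rewrite !(opprD, hdotDl, hdotDr, hdotNr) !raddfD/= !raddfN/=.
rewrite (Re_hdotC b r) -(multiplier_symmetric b r) (Re_hdotC (T b) r).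
lra.
Qed.

End multiplier.
End Markov.

(** * Growth and almost invariant sets *)

Section Folner_multipliers.
Context {R : realType} {G : groupType}.
Implicit Types (F : {fset G}) (g h : G).

(** The cardinal of [F \ gF]. *)
Definition boundary F g : nat := count (fun f => (g^-1 * f)%g \notin F) F.

(* [|F ∩ gF| / |F|], the coefficient of [left_regular g] at the unit vector
   [1_F / sqrt |F|]. *)
Definition overlap F g : R := 1 - (boundary F g)%:R / #|` F|%:R.

Lemma card_gt0 F : F != fset0 -> 0 < #|` F|%:R :> R.
Proof. by rewrite ltr0n cardfs_gt0. Qed.

Lemma boundary1 F : boundary F 1%g = 0%N.
Proof.
apply/eqP; rewrite /boundary eqn0Ngt -has_count; apply/hasPn => f fF.
by rewrite invg1 mul1g negbK.
Qed.

(** [F \ ghF] is contained in the union of [F \ gF] and the translate by [g] of [F \ hF]. *)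
Lemma boundaryM F g h : (boundary F (g * h)%g <= boundary F g + boundary F h)%N.
Proof.
rewrite /boundary -!size_filter.
set A := [seq f <- F | (g^-1 * f)%g \notin F].
set B := [seq f <- F | (h^-1 * f)%g \notin F].
have -> : (size A + size B)%N = size (A ++ [seq (g * f)%g | f <- B]).
  by rewrite size_cat size_map.
apply: uniq_leq_size => [|f]; first by rewrite filter_uniq ?fset_uniq.
rewrite mem_filter mem_cat invgM -mulgA => /andP[ghf fF].
have [gf|gf] := boolP ((g^-1 * f)%g \in F); last by rewrite mem_filter gf fF.
apply/orP; right; apply/mapP; exists (g^-1 * f)%g; last by rewrite mulVKg.
by rewrite mem_filter ghf.
Qed.

Lemma overlapE F g : F != fset0 ->
  overlap F g = (count (fun f => (g^-1 * f)%g \in F) F)%:R / #|` F|%:R.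
Proof.
move=> F0; have c0 := card_gt0 F0; rewrite /overlap.
apply: (mulIf (lt0r_neq0 c0)); rewrite mulrBl mul1r !divfK ?gt_eqF//.
apply/eqP; rewrite subr_eq -natrD eqr_nat /boundary.
by rewrite (count_predC (fun f => (g^-1 * f)%g \in F)).
Qed.

(** The Gram vectors are the normalized indicators of the sets [k^-1 F], tabulated over a finite [A]
    containing these sets for all [k] in [t]. Substituting [f = k * j] turns their inner product
    into the count defining the overlap at [k * l^-1]. *)
Lemma overlap_positive_definite F : F != fset0 -> positive_definite (overlap F).
Proof.
move=> F0 t; have c0 := card_gt0 F0.
pose A := undup [seq (k^-1 * f)%g | k <- t, f <- F].
pose chi j k : R := ((k * j)%g \in F)%:R / Num.sqrt #|` F|%:R.
exists A, chi => k l kt lt.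
have chiE j : chi j k * chi j l =
    (if (k * j)%g \in F then ((l * j)%g \in F)%:R else 0) / #|` F|%:R.
  rewrite /chi mulrACA -invfM -expr2 sqr_sqrtr ?ltW//.
  by case: ifP; rewrite ?mul1r ?mul0r.
under eq_bigr do rewrite chiE.
have chi_sum : \sum_(j <- A)
      (if (k * j)%g \in F then ((l * j)%g \in F)%:R else 0) =
    \sum_(f <- F) ((l * (k^-1 * f))%g \in F)%:R :> R.
  rewrite -big_mkcond -big_filter.
  rewrite -(big_map (fun f => (k^-1 * f)%g) xpredT
    (fun j => ((l * j)%g \in F)%:R : R)).
  apply: perm_big; apply: uniq_perm.
  - by rewrite filter_uniq// undup_uniq.
  - by rewrite map_inj_uniq ?fset_uniq//; exact: mulgI.
  move=> j; rewrite mem_filter mem_undup; apply/andP/mapP => [[kj _]|[f fF ->]].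
    by exists (k * j)%g => //; rewrite mulKg.
  rewrite mulVKg; split=> //; apply/allpairsP.
  by exists (k, f).
rewrite -mulr_suml chi_sum overlapE// -sum1_count natr_sum big_mkcond/=.
congr (_ / _); apply: eq_bigr => f _.
by rewrite invgM invgK -mulgA; case: ifP.
Qed.

(** A real Gram matrix is symmetric; the entries at [(1, g)] and [(g, 1)] are compared. *)
Lemma positive_definiteV (phi : G -> R) g : positive_definite phi ->
  phi g^-1%g = phi g.
Proof.
move=> /(_ [:: 1%g; g])[A [chi chiP]].
have := chiP 1%g g; have := chiP g 1%g; rewrite !inE !eqxx orbT mul1g invg1 mulg1.
by move=> -> // -> //; apply: eq_bigr => j _; rewrite mulrC.
Qed.

Lemma overlap_support F g : F != fset0 ->
  g \notin undup [seq (f * h^-1)%g | f <- F, h <- F] -> overlap F g = 0.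
Proof.
move=> F0 gF; rewrite overlapE// (_ : count _ _ = 0%N) ?mul0r//.
apply/eqP; rewrite eqn0Ngt -has_count; apply: contra gF => /hasP[f fF gfF].
rewrite mem_undup; apply/allpairsP; exists (f, (g^-1 * f)%g); split=> //=.
by rewrite invgM invgK mulVKg.
Qed.

Lemma overlap_markov F : F != fset0 -> markov_multiplier (overlap F).
Proof.
move=> F0; have c0 := card_gt0 F0; split.
- exact: overlap_positive_definite.
- exists (undup [seq (f * h^-1)%g | f <- F, h <- F]); first exact: undup_uniq.
  by move=> g; exact: overlap_support.
- by move=> g; rewrite overlapE// divr_ge0.
- by move=> g; rewrite gerBl divr_ge0.
- by move=> g; exact/positive_definiteV/overlap_positive_definite.
- by rewrite /overlap boundary1 mul0r subr0.
Qed.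

Lemma subr_overlap F g : 1 - overlap F g = (boundary F g)%:R / #|` F|%:R.
Proof. by rewrite /overlap opprB addrC subrK. Qed.

End Folner_multipliers.

(** * Growth of balls and the pigeonhole principle *)

Section growth_theory.
Context {G : groupType}.
Variable K : {fset G}.
Hypothesis K_sym : symmetric_fset K.
Hypothesis K_unit : (1%g : G) \in K.
Local Notation V n := (#|` pow_fset K n|).

Lemma pow_fsetSP n g : reflect (exists s t, [/\ s \in pow_fset K n, t \in K &
  g = (s * t)%g]) (g \in pow_fset K n.+1).
Proof.
apply: (iffP (imfset2P _ _ _ _ _)) => [[s sn [t tK ->]]|[s [t [sn tK ->]]]].
  by exists s, t.
by exists s => //; exists t.
Qed.

Lemma pow_fsetD m n g h : g \in pow_fset K m -> h \in pow_fset K n ->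
  (g * h)%g \in pow_fset K (m + n).
Proof.
move=> gm; elim: n h => [|n ih] h; first by rewrite inE addn0 => /eqP ->;
  rewrite mulg1.
move=> /pow_fsetSP[s [t [sn tK ->]]]; rewrite addnS; apply/pow_fsetSP.
by exists (g * s)%g, t; rewrite ih// mulgA.
Qed.

Lemma pow_fset1 g : g \in K -> g \in pow_fset K 1.
Proof.
move=> gK; apply/pow_fsetSP; exists 1%g, g; rewrite mul1g; split=> //.
by rewrite inE.
Qed.

Lemma pow_fsetV n g : g \in pow_fset K n -> (g^-1)%g \in pow_fset K n.
Proof.
elim: n g => [|n ih] g; first by rewrite !inE => /eqP ->; rewrite invg1.
move=> /pow_fsetSP[s [t [sn tK ->]]]; rewrite invgM.
exact: (@pow_fsetD 1 n _ _ (pow_fset1 (K_sym tK)) (ih _ sn)).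
Qed.

Lemma pow_fset_leq m n : (m <= n)%N -> (pow_fset K m `<=` pow_fset K n)%fset.
Proof.
move=> /subnK <-; elim: (n - m)%N => [|k ih]; first by rewrite fsubset_refl.
apply: fsubset_trans ih _; apply/fsubsetP => g gn; apply/pow_fsetSP.
by exists g, 1%g; rewrite mulg1.
Qed.

Lemma pow_fset_unit n : 1%g \in pow_fset K n.
Proof. by apply/(fsubsetP (pow_fset_leq (leq0n n))); rewrite inE. Qed.

Lemma pow_fset_neq0 n : pow_fset K n != fset0.
Proof. by apply/fset0Pn; exists 1%g; exact: pow_fset_unit. Qed.

Lemma card_pow_gt0 n : (0 < V n)%N.
Proof. by rewrite cardfs_gt0 pow_fset_neq0. Qed.

(** Translation by [g^-1] maps the ball of radius [n] into that of radius [n + 1], hence injects the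
    boundary into the sphere between them. *)
Lemma boundary_pow n g : g \in K ->
  (boundary (pow_fset K n) g <= V n.+1 - V n)%N.
Proof.
move=> gK; have sub := pow_fset_leq (leqnSn n).
have -> : (V n.+1 - V n)%N = #|` pow_fset K n.+1 `\` pow_fset K n|%fset.
  by rewrite cardfsD (fsetIidPr sub).
rewrite /boundary -size_filter.
rewrite -(size_map (fun f => (g^-1 * f)%g)); apply: uniq_leq_size.
  rewrite map_inj_uniq; last exact: mulgI.
  by rewrite filter_uniq ?fset_uniq.
move=> _ /mapP[f + ->]; rewrite mem_filter inE => /andP[-> fn] /=.
exact: (@pow_fsetD 1 n _ _ (pow_fset1 (K_sym gK)) fn).
Qed.

(** Bernoulli's inequality [1 + j / q <= (1 + 1 / q)^j], cleared of denominators; [j = q] gives the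
    doubling. *)
Lemma Bernoulli_expn q j : ((q + j) * q ^ j <= q * q.+1 ^ j)%N.
Proof.
elim: j => [|j ih]; first by rewrite addn0.
rewrite !expnS.
apply: leq_trans (_ : q.+1 * ((q + j) * q ^ j) <= _)%N; last first.
  by rewrite [leqRHS]mulnCA leq_mul2l ih orbT.
rewrite !mulnA leq_mul2r; apply/orP; right; nia.
Qed.

Lemma expn_double q : (0 < q)%N -> (2 * q ^ q <= q.+1 ^ q)%N.
Proof.
move=> q0; rewrite -(leq_pmul2l q0); apply: leq_trans (Bernoulli_expn q q).
by move: (q ^ q)%N => x; nia.
Qed.

(* Otherwise the cardinal would double every [q] steps, by [expn_double]. *)
Lemma growth_pigeonhole q m : (0 < q)%N -> (V (q * m) < 2 ^ m)%N ->
  exists2 n, (n <= q * m)%N & (q * (V n.+1 - V n) <= V n)%N.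
Proof.
move=> q0 Vm; apply: contrapT => h.
have grow n : (n <= q * m)%N -> (q.+1 * V n <= q * V n.+1)%N.
  move=> nm; have : (V n < q * (V n.+1 - V n))%N.
    by rewrite ltnNge; apply/negP => qV; apply: h; exists n.
  rewrite mulnBr ltn_subRL; nia.
have growj n j : (n + j <= q * m)%N -> (q.+1 ^ j * V n <= q ^ j * V (n + j))%N.
  elim: j => [|j ih] nj; first by rewrite addn0.
  have := grow (n + j)%N (ltnW _); rewrite addnS in nj => /(_ nj) g1.
  have := ih (ltnW nj) => g2; rewrite !expnS addnS.
  apply: leq_trans (_ : q.+1 * (q ^ j * V (n + j)) <= _)%N.
    by rewrite -mulnA leq_mul2l g2 orbT.
  by rewrite [leqLHS]mulnCA -mulnA [leqRHS]mulnCA leq_mul2l g1 orbT.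
have step i : (i <= m)%N -> (2 ^ i <= V (q * i))%N.
  elim: i => [|i ih] im; first by rewrite muln0 card_pow_gt0.
  have le_im : (q * i + q <= q * m)%N by rewrite addnC -mulnS leq_mul2l im orbT.
  have := growj _ _ le_im => g1; have := expn_double q0 => g2.
  have qq : (0 < q ^ q)%N by rewrite expn_gt0 q0.
  rewrite mulnS [(q + _)%N]addnC -(leq_pmul2l qq).
  apply: leq_trans g1; apply: leq_trans (leq_mul g2 (ih (ltnW im))).
  by rewrite expnS -mulnA mulnCA.
by move: Vm; rewrite ltnNge step.
Qed.

End growth_theory.

(** With [m = k %/ 4 + 1], [k < 4 m] gives [k^2 + k + 1 <= 21 m^2], where 21 is 16 + 4 + 1, while
    [2^k >= m^4]. The threshold ensures [C + 21 B < m], and [m <= m^2] closes the comparison. *)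
Lemma quadratic_lt_expn (C B : nat) :
  exists k0, forall k, (k0 <= k)%N -> (C + B * (k * k + k + 1) < 2 ^ k)%N.
Proof.
exists (4 * (C + 21 * B))%N => k kk.
pose j := (k %/ 4)%N; have kj : (k < 4 * j.+1)%N.
  by rewrite mulnC -ltn_divLR// ltnSn.
have jk : (4 * j <= k)%N by rewrite mulnC leq_trunc_div.
have jCB : (C + 21 * B < j.+1)%N by lia.
have h1 : ((j.+1 * j.+1) * (j.+1 * j.+1) <= 2 ^ k)%N.
  apply: (@leq_trans (2 ^ (4 * j))); last by rewrite leq_exp2l.
  have hj : (j.+1 <= 2 ^ j)%N by exact: ltn_expl.
  rewrite mulnC expnM (expnM (2 ^ j)%N 2 2) -!mulnn.
  by rewrite !leq_mul.
apply: leq_trans h1; set m := j.+1 in jCB kj *.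
have h2 : (k * k + k + 1 <= 21 * (m * m))%N by nia.
have h3 : ((C + 21 * B) * (m * m) < (m * m) * (m * m))%N.
  rewrite ltn_mul2r; apply/andP; split; [nia|].
  by apply: leq_trans jCB _; rewrite leq_pmulr.
apply: leq_trans h3; rewrite ltnS mulnDl; apply: leq_add; first by nia.
by rewrite [(21 * B)%N]mulnC -mulnA leq_mul2l h2 orbT.
Qed.

Section Folner_sequence.
Context {R : realType} {G : groupType}.
Variable K : {fset G}.
Hypothesis K_sym : symmetric_fset K.
Hypothesis K_unit : (1%g : G) \in K.
Hypothesis K_growth : polynomial_growth R K.
Local Notation V n := (#|` pow_fset K n|).

(** The hypothesis of [growth_pigeonhole] for blocks of length [q = 2^(k^2)] and [m = 2^k] of them,
    so that [q * m = 2^(k^2 + k)]. *)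
Lemma polynomial_lt_double_expn :
  exists k0, forall k, (k0 <= k)%N -> (V (2 ^ (k * k + k)) < 2 ^ (2 ^ k))%N.
Proof.
have [c [d [c0 d0 Vcd]]] := K_growth.
pose C := (Num.trunc c).+1; pose B := (Num.trunc d).+1.
have [k0 k0P] := quadratic_lt_expn C B; exists k0 => k kk.
apply: leq_ltn_trans (_ : 2 ^ (C + B * (k * k + k + 1)) < _)%N; last first.
  by rewrite ltn_exp2l// k0P.
set m := (2 ^ (k * k + k))%N.
have m0 : (0 < m)%N by rewrite expn_gt0.
rewrite -(ler_nat R) expnD natrM; apply: le_trans (Vcd m m0) _.
apply: ler_pM; rewrite ?powR_ge0 ?(ltW c0)//.
  apply: le_trans (ltW (truncnS_gt c)) _.
  by rewrite ler_nat ltnW// ltn_expl.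
apply: le_trans (_ : m.+1%:R `^ B%:R <= _).
  by apply: ler_powR; [rewrite ler1n|exact/ltW/truncnS_gt].
rewrite powR_mulrn// -natrX ler_nat mulnC expnM leq_exp2r//.
by rewrite addn1 expnS mul2n -addnn -addn1 leq_add.
Qed.

Lemma Folner_sequence : exists N : nat -> nat,
  (forall k, 2 ^ (k * k) * (V (N k).+1 - V (N k)) <= V (N k))%N /\
  exists k0, forall k, (k0 <= k)%N -> (N k <= 2 ^ (k * k + k))%N.
Proof.
have [k0 k0P] := polynomial_lt_double_expn.
have step k : exists n, (2 ^ (k * k) * (V n.+1 - V n) <= V n)%N /\
    ((k0 <= k)%N -> (n <= 2 ^ (k * k + k))%N).
  (* Below [k0] the set built for [k0] is reused: the boundary estimate is required for every [k],
     the bound on the radius only for large [k]. *)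
  pose j := maxn k k0.
  have [||n nj nV] := @growth_pigeonhole _ _ K_unit (2 ^ (j * j)) (2 ^ j).
  - by rewrite expn_gt0.
  - by rewrite -expnD k0P// leq_maxr.
  exists n; split=> [|kk].
    apply: leq_trans nV; rewrite leq_mul2r leq_exp2l// leq_mul ?leq_maxl//.
    by rewrite orbT.
  by move: nj; rewrite -expnD /j (maxn_idPl kk).
have [N NP] := choice step; exists N; split=> [k|]; first by have [] := NP k.
by exists k0 => k; have [] := NP k.
Qed.

End Folner_sequence.

(** * Homogeneous dimension and the counting of sublevel sets *)

Section homogeneous_dimension_theory.
Context {R : realType} {G : groupType}.
Variable K : {fset G}.
Hypothesis K_unit : (1%g : G) \in K.
Local Notation V n := (#|` pow_fset K n|).
Local Open Scope ereal_scope.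

Lemma homogeneous_dimension_ge0 : 0 <= homogeneous_dimension R K.
Proof.
apply: le_ereal_inf_tmp => _ [A [n _ nA] <-].
apply: (@le_trans _ _ (ln (V n)%:R / ln n%:R)%:E).
  rewrite lee_fin divr_ge0//.
    by apply: ln_ge0; rewrite ler1n; exact: card_pow_gt0.
  (* At [n = 0] the logarithm takes its default value 0. *)
  by case: (n) => [|m]; [rewrite ln0//|apply: ln_ge0; rewrite ler1n].
apply: ereal_sup_ubound; exists n => //; exact: (nA n (leqnn n)).
Qed.

Lemma homogeneous_dimension_lt (d : R) : homogeneous_dimension R K < d%:E ->
  exists n0, forall n, (n0 <= n)%N -> ((V n)%:R <= n%:R `^ d)%R.
Proof.
move=> /ereal_inf_lt[_ [A [N _ NA] <-] Ad]; exists (maxn N 2) => n.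
rewrite geq_max => /andP[Nn n2].
have : (ln (V n)%:R / ln n%:R)%:E < d%:E.
  by apply: le_lt_trans Ad; apply: ereal_sup_ubound; exists n => //; exact: NA.
have n1 : (1 < n%:R :> R)%R by rewrite ltr1n.
have ln0 : (0 < ln n%:R :> R)%R by rewrite ln_gt0.
have n0 : (0 < n%:R :> R)%R by exact: lt_trans n1.
rewrite lte_fin ltr_pdivrMr// -ln_powR ltr_ln ?posrE ?powR_gt0//.
  exact: ltW.
by rewrite ltr0n card_pow_gt0//.
Qed.

End homogeneous_dimension_theory.

Section counting.
Context {R : realType} {G : groupType}.
Variable K : {fset G}.
Hypothesis K_unit : (1%g : G) \in K.
Local Notation V n := (#|` pow_fset K n|).
Variables (l : G -> R) (k0 : nat).
Hypothesis l_large : forall k g, (k0 <= k)%N ->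
  g \notin pow_fset K (2 ^ (k * k + k).+1) -> (2 ^ (k * k.-1))%:R <= l g.

Lemma sublevel_subset k (x : R) g : (k0 <= k)%N -> x < (2 ^ (k * k.-1))%:R ->
  l g <= x -> g \in pow_fset K (2 ^ (k * k + k).+1).
Proof.
move=> kk xk gx; apply: contraLR xk => gK.
by rewrite -leNgt; apply: le_trans (l_large kk gK) gx.
Qed.

Lemma exists_level (k1 : nat) (x : R) :
  exists2 k, (k1 <= k)%N & x < (2 ^ (k * k.-1))%:R.
Proof.
(* The [.+2] forces [k >= 2], whence [k <= k * k.-1]. *)
exists (maxn k1 (Num.trunc x).+2); first exact: leq_maxl.
apply: lt_le_trans (truncnS_gt x) _; rewrite ler_nat.
set k := maxn _ _; have k2 : ((Num.trunc x).+2 <= k)%N by exact: leq_maxr.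
apply: (@leq_trans (2 ^ k)).
  by apply: leq_trans (ltnW (ltn_expl k (ltnSn 1))); exact: ltnW.
by rewrite leq_exp2l//; move: k2; case: (k) => // m /=; case: m => // m _; nia.
Qed.

Lemma sublevel_finite (x : R) : exists s : seq G, forall g, l g <= x -> g \in s.
Proof.
have [k kk xk] := exists_level k0 x.
exists (pow_fset K (2 ^ (k * k + k).+1)) => g; exact: sublevel_subset.
Qed.

Lemma sublevel_count (d : R) : (homogeneous_dimension R K < d%:E)%E ->
  exists x0 : R, forall x, x0 <= x -> exists s : seq G,
    [/\ uniq s, forall g, l g <= x -> g \in s & (size s)%:R <= x `^ d].
Proof.
move=> Kd.
(* The growth bound is used with an exponent strictly below [d]; the margin [d - d'] absorbs the
   linear terms of the exponents. *)
have [d' [Kd' d'd d'0]] : exists d' : R,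
    [/\ (homogeneous_dimension R K < d'%:E)%E, d' < d & 0 < d'].
  move: Kd (homogeneous_dimension_ge0 (R := R) K_unit).
  case: (homogeneous_dimension R K) => [h| |]//; rewrite lte_fin lee_fin => hd h0.
  by exists ((h + d) / 2); rewrite lte_fin; split; lra.
have [n0 n0P] := homogeneous_dimension_lt K_unit Kd'.
(* With [j = k - 1], the goal is [d' (j^2 + 3 j + 3) <= d (j^2 - j)]. For [j >= 1] the constant 3 is
   at most [3 j], so [6 d' + d <= (d - d') j] suffices. *)
pose J := (6 * d' + d) / (d - d').
pose k1 := (maxn (maxn k0 n0) (maxn 1 (Num.trunc J).+1)).
have k1k0 : (k0 <= k1)%N by rewrite !leq_max leqnn.
have k1n0 : (n0 <= k1)%N by rewrite !leq_max leqnn orbT.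
have k11 : (1 <= k1)%N by rewrite !leq_max leqnn !orbT.
have k1J : J <= k1%:R.
  apply: le_trans (ltW (truncnS_gt J)) _.
  by rewrite ler_nat !leq_max leqnn !orbT.
exists (2 ^ (k1 * k1.-1))%:R => x k1x.
have ex : exists k, (k1 <= k)%N && (x < (2 ^ (k * k.-1))%:R).
  by have [k kk xk] := exists_level k1 x; exists k; rewrite kk.
(* The least level above [x]: the preceding one is at most [x], and the lower bound on [x] forces
   [k > k1]. *)
case: (ex_minnP ex) => k /andP[kk xk] kmin.
have {}kk : (k1 < k)%N.
  rewrite ltn_neqAle kk andbT; apply/eqP => k1k.
  by move: xk; rewrite -k1k ltNge k1x.
have {}kmin : (2 ^ (k.-1 * k.-2))%:R <= x.
  rewrite leNgt; apply/negP => xk1; have := kmin k.-1.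
  by rewrite xk1 andbT; case: (k) kk => // m; rewrite ltnS => -> /(_ isT); rewrite ltnn.
exists (pow_fset K (2 ^ (k * k + k).+1)); split; first exact: fset_uniq.
  by move=> g; apply: sublevel_subset => //; apply: leq_trans (ltnW kk).
apply: le_trans (n0P _ _) _.
  apply: leq_trans k1n0 _; apply: leq_trans (ltnW kk) _.
  apply: leq_trans (ltnW (ltn_expl k (ltnSn 1))) _; rewrite leq_exp2l//; lia.
have x0 : 0 <= x by apply: le_trans kmin; rewrite ler0n.
apply: le_trans (_ : (2 ^ (k.-1 * k.-2))%:R `^ d <= _); last first.
  by apply: ge0_ler_powR; rewrite ?nnegrE//; lra.
have two m (e : R) : (2 ^ m)%:R `^ e = 2 `^ (m%:R * e).
  by rewrite powRrM powR_mulrn// natrX.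
rewrite !two; apply: ler_powR; first by rewrite ler1n.
case: k kk {xk kmin x0} => // j; rewrite ltnS => kj /=.
have jE : ((j.+1 * j.+1 + j.+1).+1%:R : R) = j%:R ^+ 2 + 3 * j%:R + 3.
  by rewrite -[in LHS]addn1 !natrD natrM -[j.+1%:R]natr1; ring.
have jE' : ((j * j.-1)%:R : R) = j%:R ^+ 2 - j%:R.
  have j1 : (1 <= j)%N by exact: leq_trans kj.
  by case: (j) j1 => // m _; rewrite succnK natrM -natr1; ring.
rewrite jE jE'.
have j1 : 1 <= j%:R :> R by rewrite ler1n; exact: leq_trans kj.
have jJ : J <= j%:R by apply: le_trans k1J _; rewrite ler_nat.
have {}jJ : 6 * d' + d <= (d - d') * j%:R.
  by rewrite [leRHS]mulrC -ler_pdivrMr ?subr_gt0.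
move: j%:R j1 jJ => t t1 tJ.
have := ler_wpM2r (le_trans ler01 t1) tJ; nra.
Qed.

End counting.

(** * The Dirichlet form *)

Section superposition.
Context {R : realType} {G : groupType}.
Variables (phi : nat -> G -> R) (c : nat -> R).
Hypothesis phi_markov : forall k, markov_multiplier (phi k).
Hypothesis c_ge0 : forall k, 0 <= c k.

Definition partial_weight n g : R := \sum_(k < n) c k * (1 - phi k g).

Hypothesis partial_weight_bounded :
  forall g, exists M, forall n, partial_weight n g <= M.

Definition weight g : R := limn (partial_weight^~ g).

Lemma weight_term_ge0 k g : 0 <= c k * (1 - phi k g).
Proof. by rewrite mulr_ge0// subr_ge0; exact: multiplier_le1. Qed.

Lemma partial_weight_ge0 n g : 0 <= partial_weight n g.
Proof. by apply: sumr_ge0 => k _; exact: weight_term_ge0. Qed.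

Lemma partial_weight_cvg g : partial_weight^~ g @ \oo --> weight g.
Proof.
apply: nondecreasing_is_cvgn.
  apply/nondecreasing_seqP => n; rewrite /partial_weight big_ord_recr/=.
  by rewrite lerDl weight_term_ge0.
by have [M MP] := partial_weight_bounded g; exists M => _ [n _ <-].
Qed.

Lemma partial_weight_le n g : partial_weight n g <= weight g.
Proof.
have cv : cvgn (partial_weight^~ g) by apply: cvgP; exact: partial_weight_cvg.
apply: (nondecreasing_cvgn_le _ cv); apply/nondecreasing_seqP => m.
by rewrite /partial_weight big_ord_recr/= lerDl weight_term_ge0.
Qed.

Lemma weight_ge0 g : 0 <= weight g.
Proof. exact: le_trans (partial_weight_ge0 0 g) (partial_weight_le 0 g). Qed.

Lemma weight_ge_term k g : c k * (1 - phi k g) <= weight g.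
Proof.
apply: le_trans (partial_weight_le k.+1 g).
by rewrite /partial_weight big_ord_recr/= lerDr partial_weight_ge0.
Qed.

Lemma weightV g : weight g^-1%g = weight g.
Proof.
rewrite /weight; congr (limn _); apply/funext => n.
by apply: eq_bigr => k _; rewrite multiplier_inv.
Qed.

(** Over finitely many [g] the limit in [n] passes through the sum; the infinite sum over the group
    is only taken afterwards. *)
Lemma sum_weight_le (s : seq G) (f : G -> R) (M : R) :
  (forall n, \sum_(g <- s) partial_weight n g * f g <= M) ->
  \sum_(g <- s) weight g * f g <= M.
Proof.
move=> nM.
have cv : (fun n => \sum_(g <- s) partial_weight n g * f g) @ \oo -->
    \sum_(g <- s) weight g * f g.
  elim: s {nM} => [|g s ih].
    rewrite big_nil (_ : (fun _ => _) = cst 0); first exact: cvg_cst.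
    by apply/funext => n; rewrite big_nil.
  rewrite big_cons (_ : (fun _ => _) = (fun n => partial_weight n g * f g) \+
    (fun n => \sum_(g <- s) partial_weight n g * f g)).
    by apply: cvgD ih; apply: cvgMl; exact: partial_weight_cvg.
  by apply/funext => n; rewrite big_cons.
by apply: (cvgr_to_le cv); apply: nearW => n; exact: nM.
Qed.

Variable L2G : gns (group_vN R G) (canonical_trace R G).
Variable J : L2G -> L2G.
Hypothesis J_star : antiunitary_star_extension J.
Local Notation U := (@gns_coord R G L2G).
Local Notation U_linear := (@gns_coord_linear R G L2G).
Local Notation U_dot := (@gns_coord_dot R G L2G).
Local Notation U_surj := (@gns_coord_surj R G L2G).
Let q (g : G) : R[i] := (Num.sqrt (weight g))%:C.
Let S := diag_mul U_surj q.
Implicit Types (a b : L2G).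

Definition weight_dom : set L2G := diag_dom U q.

Definition weight_form a : R := sqn (S a).

Lemma weight_quadratic_form : quadratic_form weight_dom weight_form.
Proof.
have lin z a b (Fa : weight_dom a) (Fb : weight_dom b) :=
  diag_mul_lin U_linear U_dot U_surj z Fa Fb.
split.
  by split=> [|z a b Fa Fb]; [exact: (diag_dom0 U_linear)|have [] := lin z a b Fa Fb].
exists (fun a b => hdot (S a) (S b)).
split=> [z a b d Fa Fb Fd|z a b d Fa Fb Fd|a Fa].
- by have [_ h] := lin z b d Fb Fd; rewrite /S h hdotPr.
- by have [_ h] := lin z b d Fb Fd; rewrite /S h hdotDl hdotZl.
- by rewrite hdotE.
Qed.

Lemma weight_closed_form : closed_form weight_dom weight_form.
Proof.
move=> u a uF ua uC.
have [Fa h] := diag_sqrt_closed U_linear U_dot weight_ge0 uF ua uC.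
split=> //; apply/cvgrPdist_lt => e e0; have [N NP] := h e e0.
exists N => // n /NP /= ne.
by rewrite sub0r normrN ger0_norm ?sqn_ge0.
Qed.

Lemma weight_real_form : real_form J weight_dom weight_form.
Proof.
move=> a Fa; have [_ Jdot _ _] := J_star.
have h g : U (J (S a)) g = q g * U (J a) g.
  rewrite !(gns_star_coord J_star) diag_mulE// [LHS]conj_realM.
  by rewrite weightV.
have [FJa SJa] := diag_mul_unique U_linear U_dot U_surj h.
by split=> //; rewrite /weight_form /S SJa /sqn Jdot.
Qed.

(** Each finite sum for [b] with a partial weight is at most [sum_(k < n) c_k E_k[b]], with [E_k]
    the form of [phi k]. This is at most the same sum at [a], hence at most [E[a]], uniformly in [n]
    and in the finite set. *)
Lemma weight_markovian_form : markovian_form J weight_dom weight_form.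
Proof.
move=> a b Fa Ja ab.
apply: (diag_sqrt_bound U_dot U_surj weight_ge0) => s us; apply: sum_weight_le => n.
have msum x k : rsummable (fun g => (1 - phi k g) * sqmod (U x g)).
  apply: le_rsummable (l2_sq (U x)) => g; have pm := phi_markov k.
  rewrite normrM ler_piMl// ger0_norm ?subr_ge0 ?(multiplier_le1 pm)//.
  by rewrite gerBl (multiplier_ge0 pm).
(* Partial weights are bounded, so these sums converge for every [x], in particular for [b] before
   it is known to lie in the domain. *)
have formsum x m : rsummable (fun g => partial_weight m g * sqmod (U x g)) /\
    rsum (fun g => partial_weight m g * sqmod (U x g)) =
    \sum_(k < m) c k * multiplier_form (phi k) x.
  elim: m => [|m [ihs ihE]].
    rewrite big_ord0; have z : (fun g => partial_weight 0 g * sqmod (U x g)) = cst 0.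
      by apply/funext => g; rewrite /partial_weight big_ord0 mul0r.
    by rewrite z; split; [rewrite /rsummable esum1// => g _; rewrite normr0|
      rewrite rsum_pos// esum1].
  have z : (fun g => partial_weight m.+1 g * sqmod (U x g)) =
      (fun g => partial_weight m g * sqmod (U x g) +
         c m * ((1 - phi m g) * sqmod (U x g))).
    by apply/funext => g; rewrite /partial_weight big_ord_recr/= mulrDl mulrA.
  have sm := rsummableZ (c m) (msum x m).
  rewrite z big_ord_recr/= -ihE /multiplier_form -rsumZ -rsumD//; split=> //.
  exact: rsummableD.
have [sb Eb] := formsum b n; have [sa Ea] := formsum a n.
apply: (@le_trans _ _ (rsum (fun g => partial_weight n g * sqmod (U b g)))).
  apply: (@rsum_ge_seq _ _ (fun g => partial_weight n g * sqmod (U b g))) => // g.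
  by rewrite mulr_ge0 ?partial_weight_ge0 ?sqmod_ge0.
rewrite Eb.
apply: (@le_trans _ _ (rsum (fun g => partial_weight n g * sqmod (U a g)))).
  rewrite Ea; apply: ler_sum => k _; rewrite ler_wpM2l//.
  exact: (multiplier_form_markov J_star (phi_markov k) ab).
rewrite /weight_form /S (sqn_diag_sqrt U_dot U_surj weight_ge0 Fa).
apply: le_rsum => // [|g].
  exact: (diag_sqrt_summable weight_ge0 Fa).
by rewrite ler_wpM2r ?sqmod_ge0// partial_weight_le.
Qed.

Lemma weight_dirichlet_form : dirichlet_form J weight_dom weight_form.
Proof.
split; [split|exact: weight_real_form|exact: weight_markovian_form].
- exact: weight_quadratic_form.
- by move=> a _; exact: sqn_ge0.
- exact: (diag_dom_dense U_linear U_dot U_surj).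
- exact: weight_closed_form.
Qed.

Lemma weight_associated_operator :
  associated_operator weight_dom weight_form (diag_op U_surj weight).
Proof.
split.
- exact: (diag_self_adjoint U_linear U_dot).
- exact: (diag_nonneg U_dot weight_ge0).
exists (diag_op U_surj (fun g => Num.sqrt (weight g))); split=> [||a Fa] //.
  exact: (diag_is_sqrt U_linear U_dot _ weight_ge0).
by rewrite normh_sqn.
Qed.

End superposition.

(** Every real [d > h] competes in the infimum; [0 <= h] makes such a [d] positive, as the
    definition demands. *)
Lemma upper_spectral_dimension_le (R : realType) (H : hilbertType R)
    (L : @operator R H) (h : \bar R) : (0 <= h)%E ->
  (forall d : R, (h < d%:E)%E -> exists x0 : R, forall x, x0 <= x ->
     (eigenvalue_count L x <= (x `^ d)%:E)%E) ->
  (upper_spectral_dimension L <= h)%E.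
Proof.
case: h => [r| |]// r0 hL; last by rewrite leey.
apply/lee_addgt0Pr => e e0; apply: ereal_inf_lbound; exists (r + e) => //.
split; first by rewrite ltr_wpDl.
have [|x0 x0P] := hL (r + e); first by rewrite lte_fin ltrDl.
apply: le_lt_trans (ltry 1); apply: ge_ereal_inf.
(* The maximum with 1 keeps [x] positive, hence its power invertible. *)
exists (ereal_sup [set (eigenvalue_count L x * ((x `^ (r + e))^-1)%:E)%E | x in
  [set x | Num.max x0 1 <= x]]).
  exists [set x | Num.max x0 1 <= x] => //.
  by apply: nbhs_pinfty_ge; exact: num_real.
apply: ge_ereal_sup => _ [x /= xx0 <-].
move: xx0; rewrite ge_max => /andP[x0x x1].
have p0 : 0 < x `^ (r + e) by rewrite powR_gt0// (lt_le_trans ltr01).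
rewrite lee_pdivrMr// mul1e; exact: x0P.
Qed.

(** * The weight attached to almost invariant balls *)

Section length_weight.
Context {R : realType} {G : groupType}.
Variable K : {fset G}.
Hypothesis K_sym : symmetric_fset K.
Hypothesis K_unit : (1%g : G) \in K.
Hypothesis K_gen : generating_fset K.
Variable N : nat -> nat.
Hypothesis N_Folner : forall k,
  (2 ^ (k * k) * (#|` pow_fset K (N k).+1| - #|` pow_fset K (N k)|) <=
   #|` pow_fset K (N k)|)%N.

Let F k := pow_fset K (N k).
Let c k : R := (2 ^ (k * k.-1))%:R.

(** The boundary ratio is at most [2^(-k^2)], and [k (k - 1) - k^2 = - k]: the exponent of [c] is
    chosen to leave a geometric series. *)
Lemma Folner_term k g : g \in K -> c k * (1 - overlap (F k) g) <= 2^-1 ^+ k.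
Proof.
move=> gK; have F0 : 0 < #|` F k|%:R :> R.
  by rewrite ltr0n card_pow_gt0.
rewrite subr_overlap mulrA ler_pdivrMr// exprVn ler_pdivlMl ?exprn_gt0//.
rewrite -natrX -!natrM ler_nat mulnA -expnD.
have -> : (k + k * k.-1 = k * k)%N by case: (k) => // m /=; rewrite -mulnS.
apply: leq_trans (N_Folner k); rewrite leq_mul2l; apply/orP; right.
exact: boundary_pow.
Qed.

Lemma geometric_half_le n : \sum_(k < n) (2^-1 : R) ^+ k <= 2.
Proof.
suff -> : \sum_(k < n) (2^-1 : R) ^+ k = 2 - 2 * 2^-1 ^+ n.
  by rewrite gerBl mulr_ge0// exprn_ge0// invr_ge0.
elim: n => [|n ih]; first by rewrite big_ord0 expr0; ring.
by rewrite big_ord_recr/= ih exprS; field.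
Qed.

Lemma Folner_weight_bounded g : exists M, forall n,
  partial_weight (fun k => overlap (F k)) c n g <= M.
Proof.
have F0 k : 0 < #|` F k|%:R :> R by rewrite ltr0n card_pow_gt0.
pose W n g := partial_weight (fun k => overlap (F k)) c n g.
have WM n g1 g2 : W n (g1 * g2)%g <= W n g1 + W n g2.
  rewrite /W /partial_weight -big_split/=; apply: ler_sum => k _.
  rewrite -mulrDr ler_wpM2l ?ler0n// !subr_overlap -mulrDl.
  by rewrite ler_pM2r ?invr_gt0// -natrD ler_nat boundaryM.
have WV n g1 : W n g1^-1%g = W n g1.
  apply: eq_bigr => k _; congr (_ * (1 - _)).
  exact/positive_definiteV/overlap_positive_definite/pow_fset_neq0.
suff : [set g | exists M, forall n, W n g <= M] = [set: G].
  by move=> /seteqP[_ /(_ g)]; exact.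
apply: K_gen => /=.
- exists 0 => n; rewrite /W /partial_weight big1// => k _.
  by rewrite subr_overlap boundary1 mul0r mulr0.
- move=> g1 g2 [M1 M1P] [M2 M2P]; exists (M1 + M2) => n.
  by apply: le_trans (WM _ _ _) _; rewrite WV lerD.
- move=> g1 gK; exists 2 => n; apply: le_trans (geometric_half_le n).
  by apply: ler_sum => k _; exact: Folner_term.
Qed.

Lemma Folner_weight_large (k0 : nat) :
  (forall k, (k0 <= k)%N -> (N k <= 2 ^ (k * k + k))%N) ->
  forall k g, (k0 <= k)%N -> g \notin pow_fset K (2 ^ (k * k + k).+1) ->
  c k <= weight (fun k => overlap (F k)) c g.
Proof.
move=> Nk0 k g kk gK.
have Fne j : F j != fset0 by exact: pow_fset_neq0.
have markov j : markov_multiplier (overlap (F j) : G -> R).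
  exact: overlap_markov.
have := weight_ge_term markov (fun k => ler0n R _) Folner_weight_bounded k g.
apply: le_trans; rewrite overlap_support ?subr0 ?mulr1//.
apply: contra gK; rewrite mem_undup => /allpairsP[[f h] /= [fF hF ->]].
(* The overlap is supported in the product of the ball and its inverse, so the radius doubles; this
   is the [.+1] in the exponent. *)
apply: (fsubsetP (pow_fset_leq K_unit (_ : N k + N k <= _)%N)).
  by rewrite expnS mul2n -addnn leq_add// Nk0.
by apply: pow_fsetD => //; exact: pow_fsetV.
Qed.

End length_weight.

Theorem corollary1p3 (R : realType) (G : groupType) (K : {fset G})
    (hsym : symmetric_fset K) (h1 : (1%g : G) \in K) (hgen : generating_fset K)
    (hgrowth : polynomial_growth R K)
    (L2G : gns (group_vN R G) (canonical_trace R G))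
    (J : L2G -> L2G) (hJ : antiunitary_star_extension J) :
  exists (F : set L2G) (E : L2G -> R) (L : @operator R L2G),
    [/\ dirichlet_form J F E,
        associated_operator F E L,
        discrete_spectrum L &
        (upper_spectral_dimension L <= homogeneous_dimension R K)%E].
Proof.
have [N [NF [k0 Nk0]]] := Folner_sequence h1 hgrowth.
pose phi k := overlap (R := R) (pow_fset K (N k)).
pose c k : R := (2 ^ (k * k.-1))%:R.
have markov k : markov_multiplier (phi k).
  exact/overlap_markov/pow_fset_neq0.
have c0 k : 0 <= c k by exact: ler0n.
have bounded := Folner_weight_bounded (R := R) hsym h1 hgen NF.
have large := Folner_weight_large (R := R) hsym h1 hgen NF Nk0.
pose l := weight phi c.
have proper (x : R) : exists s : seq G, forall g, l g <= x -> g \in s.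
  exact: sublevel_finite large x.
have U_linear := @gns_coord_linear R G L2G.
have U_dot := @gns_coord_dot R G L2G.
exists (weight_dom phi c (L2G := L2G)), (weight_form phi c (L2G := L2G)).
exists (diag_op (@gns_coord_surj R G L2G) l); split.
- exact: weight_dirichlet_form.
- exact: weight_associated_operator.
- exact: (diag_discrete_spectrum U_linear U_dot proper).
apply: upper_spectral_dimension_le; first exact: homogeneous_dimension_ge0.
move=> d Kd; have [x0 x0P] := sublevel_count h1 large Kd.
exists x0 => x /x0P[s [us sx sd]].
apply: le_trans (diag_eigenvalue_count U_linear U_dot _ us sx) _.
by rewrite lee_fin.
Qed.
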